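(* Let $\mathcal{G}$ be Spielberg's groupoid associated with the mixed graph $\Omega$ built from irreducible directed graphs $E_0,E_1,F_0,F_1$ and the graph $D$ (as constructed in the context). Then $\mathcal{G}$ is purely infinite.
   Context: The mixed graph $\Omega$. $D$ is the directed graph with vertices $u_0,u_1,a_0,a_1$ and edges $\alpha_0:u_0\to a_0$, $\delta_0:a_0\to u_1$, $\alpha_1:u_1\to a_1$, $\delta_1:a_1\to u_0$, $\varepsilon_0:u_0\to u_1$, $\varepsilon_1:u_1\to u_0$, loops $\beta_0,\gamma_0$ at $a_0$ and loops $\beta_1,\gamma_1$ at $a_1$. $E_0,E_1,F_0,F_1$ are (countable) irreducible directed graphs (any two vertices are connected by a directed path). For $i=0,1$, $L_i\subseteq E_i^0$ and $M_i\subseteq F_i^0$ are the sets of vertices emitting infinitely many edges; all are assumed nonempty, and $v_i\in L_i$, $w_i\in M_i$ are fixed. $\Omega$ is obtained from $D$ and the product 2-graphs $E_i\times F_i$ by identifying $u_i$ with $(v_i,w_i)$, $i=0,1$. A vertex of $\Omega$ is an element of $\bigcup_i(E_i^0\times F_i^0)\cup D^0$ with these identifications; edges are elements of $\bigcup_i\big((E_i^1\times F_i^0)\cup(E_i^0\times F_i^1)\big)\cup D^1$. Paths. A finite path element of type $D$ is a finite directed path in $D$ of nonzero length; an infinite path element of type $D$ is an infinite directed path in $D$ or a finite path element of type $D$ ending at $u_0$ or $u_1$. A finite path element of type $(E_i,F_i)$ is a pair $(p,q)\in E_i^*\times F_i^*$ of finite directed paths, at least one of positive length; an infinite path element of type $(E_i,F_i)$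 is a pair $(p,q)$, not both of length zero, where $p$ is an infinite path in $E_i$ or a finite path terminating in $L_i$, and $q$ is an infinite path in $F_i$ or a finite path terminating in $M_i$. Origin and terminus $o,t$ are defined coordinatewise, and $(p',q')$ extends $(p,q)$ if $p'$ extends $p$ and $q'$ extends $q$. A finite path is a vertex of $\Omega$ or a finite string $\mu_1\cdots\mu_k$ of finite path elements with $t(\mu_i)=o(\mu_{i+1})$ and with $\mu_i,\mu_{i+1}$ of different types. An infinite path is a vertex in some $L_i\times M_i$, an infinite string of finite path elements with these two properties, or a finite string $\mu_1\cdots\mu_{k+1}$ with these two properties in which $\mu_1,\dots,\mu_k$ are finite path elements and $\mu_{k+1}$ is an infinite path element. $\mu\preceq\nu$ means $\nu$ extends $\mu$. Paths are concatenated in the obvious way, adjacent path elements of the same type being merged (coordinatewise for type $(E_i,F_i)$). Let $X$ be the set of all infinite paths. Topology. For a finite path $\mu=\mu_1\cdots\mu_k$, $Z(\mu)=\{\sigma=\sigma_1\sigma_2\cdots\in X:\sigma_i=\mu_i\text{ for }i<k,\ \mu_k\preceq\sigma_k\}$ (for a vertex $\mu$, the infinite paths with origin $\mu$). $V(\mu)=Z(\mu)$ if $t(\mu)\notin\{u_0,u_1\}$, and $V(\mu)=Z(\mu)\setminus(Z(\mu\alpha_i)\cup Z(\mu\varepsilon_i))$ if $t(\mu)=u_i$. If $t(\mu)=(y,z)\in E_i^0\times F_i^0$ and $B$, $C$ are finite sets of edges of $E_i$, $F_i$ emitted from $y$, $z$ respectively (with $B=\emptyset$ if $y\notin L_i$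 and $C=\emptyset$ if $z\notin M_i$), put $V(\mu;B,C)=V(\mu)\setminus\big(\bigcup_{e\in B}Z(\mu(e,z))\cup\bigcup_{f\in C}Z(\mu(y,f))\big)$. The sets $Z(\mu)$ and $V(\mu;B,C)$ form a base of a locally compact metrizable topology on $X$. The groupoid. $\ell(\mu)\in\mathbb{N}^2$ is $(0,0)$ for a vertex, $(\ell(p),\ell(p))$ for a finite path element $p$ of type $D$, $(\ell(p),\ell(q))$ for $(p,q)$ of type $(E_i,F_i)$, and is additive over the path elements of a finite path. $\mathcal{G}$ is the set of $(x,n,y)\in X\times\mathbb{Z}^2\times X$ such that there are $z\in X$ and finite paths $\mu,\nu$ with $x=\mu z$, $y=\nu z$, $\ell(\mu)-\ell(\nu)=n$, with $(x,n,y)(y,m,z)=(x,n+m,z)$ and $(x,n,y)^{-1}=(y,-n,x)$. Its topology has as base the compact open bisections $U(\mu_1,\mu_2)=\{(\mu_1z,\ell(\mu_1)-\ell(\mu_2),\mu_2z)\}$ (with $\mu_iz\in Z(\mu_i)$) and $U_0(\mu_1,\mu_2;B,C)$, the subset of $U(\mu_1,\mu_2)$ with $\mu_iz\in V(\mu_i;B,C)$, where $\mu_1,\mu_2$ are finite paths with $t(\mu_1)=t(\mu_2)$. $\mathcal{G}$ is a locally compact Hausdorff ample étale groupoid with unit space $X$, source $s$ and range $r$. Purely infinite. An open $s$-section is an open set $A\subseteq\mathcal{G}$ such that $s|_A$ is a homeomorphism onto an open subset of $\mathcal{G}^{(0)}$. For $K\subseteq\mathcal{G}^{(0)}$ and $O\subseteq\mathcal{G}^{(0)}$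 open, $K\prec_{\mathcal{G}}O$ means that there is an open $s$-section $A$ with $K\subseteq r(A)$, $s(A)\subseteq O$. For open $U,V$, $U\precsim_{\mathcal{G},2}V$ means that for every compact $K\subseteq U$ there are disjoint nonempty open $V_1,V_2\subseteq V$ with $K\prec_{\mathcal{G}}V_1$, $K\prec_{\mathcal{G}}V_2$. $\mathcal{G}$ is purely infinite if $O_1\precsim_{\mathcal{G},2}O_2$ for all nonempty open $O_1,O_2\subseteq\mathcal{G}^{(0)}$ with $O_1\subseteq r(\{\gamma\in\mathcal{G}:s(\gamma)\in O_2\})$. *)

(* Defs.v *)
From HB Require Import structures.
From mathcomp Require Import all_boot all_order all_algebra.
From mathcomp Require Import boolp classical_sets functions cardinality.
From mathcomp Require Import topology.

Set Implicit Arguments.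
Unset Strict Implicit.
Unset Printing Implicit Defensive.

Import GRing.Theory.

Local Open Scope classical_set_scope.

(* Only the range and source maps into the unit space [X] and the two
   topologies enter the definition, so it is stated for these data. *)
Section PurelyInfinite.
Context (G X : topologicalType) (r s : G -> X).

Definition open_s_section (A : set G) : Prop :=
  [/\ open A, open (s @` A) &
      exists t : X -> G, [/\ {in A, cancel s t}, {within A, continuous s}
                           & {within s @` A, continuous t}]].

Definition prec (K O : set X) : Prop :=
  exists A : set G, [/\ open_s_section A, K `<=` r @` A & s @` A `<=` O].

Definition precsim2 (U V : set X) : Prop :=
  forall K : set X, compact K -> K `<=` U ->
  exists V1 V2 : set X,
    [/\ open V1 /\ open V2, V1 !=set0 /\ V2 !=set0, V1 `<=` V /\ V2 `<=` V,
        V1 `&` V2 = set0 & prec K V1 /\ prec K V2].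

Definition purely_infinite : Prop :=
  forall O1 O2 : set X, open O1 -> open O2 -> O1 !=set0 -> O2 !=set0 ->
    O1 `<=` r @` [set g | O2 (s g)] -> precsim2 O1 O2.

End PurelyInfinite.

Record digraph := Digraph {
  vert : Type;
  edge : Type;
  orig : edge -> vert;
  term : edge -> vert }.

Definition countable_graph (G : digraph) : Prop :=
  countable [set: vert G] /\ countable [set: edge G].

Section Digraph.
Context {G : digraph}.

Definition finpath : Type := (vert G * seq (edge G))%type.

Fixpoint walk (y : vert G) (es : seq (edge G)) : Prop :=
  if es is e :: es' then orig e = y /\ walk (term e) es' else True.

Definition is_finpath (p : finpath) : Prop := walk p.1 p.2.

Definition finpath_term (p : finpath) : vert G := last p.1 (map (@term G) p.2).

Definition finpath_len (p : finpath) : nat := size p.2.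

Inductive gpath : Type :=
  | Fin of finpath
  | Inf of nat -> edge G.

Definition is_gpath (p : gpath) : Prop :=
  match p with
  | Fin p => is_finpath p
  | Inf f => forall n, term (f n) = orig (f n.+1)
  end.

Definition gpath_orig (p : gpath) : vert G :=
  match p with Fin p => p.1 | Inf f => orig (f 0) end.

Definition gpath_null (p : gpath) : Prop :=
  if p is Fin p then finpath_len p = 0 else False.

Definition ends_in (S : set (vert G)) (p : gpath) : Prop :=
  if p is Fin p then S (finpath_term p) else True.

Definition gpath_ext (p : finpath) (q : gpath) : Prop :=
  match q with
  | Fin q => p.1 = q.1 /\ exists es, q.2 = p.2 ++ es
  | Inf f => p.1 = orig (f 0) /\ p.2 = mkseq f (size p.2)
  end.

Definition finpath_cat (p q : finpath) : finpath := (p.1, p.2 ++ q.2).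

Definition gpath_cat (p : finpath) (q : gpath) : gpath :=
  match q with
  | Fin q => Fin (finpath_cat p q)
  | Inf f => Inf (fun n => if n < size p.2 then nth (f 0) p.2 n
                           else f (n - size p.2))
  end.

Definition inf_emitter : set (vert G) :=
  [set y | infinite_set [set e : edge G | orig e = y]].

End Digraph.

Arguments finpath : clear implicits.
Arguments gpath : clear implicits.
Arguments inf_emitter : clear implicits.

Definition irreducible (G : digraph) : Prop :=
  forall y z : vert G, exists p : finpath G,
    [/\ is_finpath p, p.1 = y & finpath_term p = z].

(* The index i in {0,1} is a boolean, so [~~ i] is the other index. *)

Inductive D_vert := Du of bool | Da of bool.

Inductive D_edge :=
  | Dalpha of bool | Ddelta of bool | Depsilon of bool
  | Dbeta of bool | Dgamma of bool.

Definition D_orig (e : D_edge) : D_vert :=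
  match e with
  | Dalpha i | Depsilon i => Du i
  | Ddelta i | Dbeta i | Dgamma i => Da i
  end.

Definition D_term (e : D_edge) : D_vert :=
  match e with
  | Dalpha i | Dbeta i | Dgamma i => Da i
  | Ddelta i | Depsilon i => Du (~~ i)
  end.

Definition Dgraph : digraph := Digraph D_orig D_term.

Section MixedGraph.
Context {E F : bool -> digraph}
        (v : forall i, vert (E i)) (w : forall i, vert (F i)).

(* The identification of [u_i] with [(v_i, w_i)] is built in: the only
   vertices outside the two products are [a_0] and [a_1]. *)
Inductive Overt :=
  | Oprod (i : bool) of vert (E i) & vert (F i)
  | Oa of bool.

Definition Ou (i : bool) : Overt := Oprod (v i) (w i).

Definition Overt_of_D (x : D_vert) : Overt :=
  match x with Du i => Ou i | Da i => Oa i end.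

Inductive felt :=
  | FD of finpath Dgraph
  | FP (i : bool) of finpath (E i) & finpath (F i).

(* Common carrier of the finite and of the infinite path elements. *)
Inductive elt :=
  | GD of gpath Dgraph
  | GP (i : bool) of gpath (E i) & gpath (F i).

Definition elt_of (m : felt) : elt :=
  match m with
  | FD p => GD (Fin p)
  | FP i p q => GP (Fin p) (Fin q)
  end.

Definition elt_type (m : elt) : option bool :=
  match m with GD _ => None | GP i _ _ => Some i end.

Definition elt_orig (m : elt) : Overt :=
  match m with
  | GD p => Overt_of_D (gpath_orig p)
  | GP i p q => Oprod (gpath_orig p) (gpath_orig q)
  end.

Definition felt_term (m : felt) : Overt :=
  match m with
  | FD p => Overt_of_D (finpath_term p)
  | FP i p q => Oprod (finpath_term p) (finpath_term q)
  end.

Definition is_felt (m : felt) : Prop :=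
  match m with
  | FD p => is_finpath p /\ 0 < finpath_len p
  | FP i p q =>
      [/\ is_finpath p, is_finpath q & 0 < finpath_len p \/ 0 < finpath_len q]
  end.

Definition is_ielt (m : elt) : Prop :=
  match m with
  | GD p =>
      [/\ is_gpath p, ~ gpath_null p
        & ends_in (range Du : set (vert Dgraph)) p]
  | GP i p q =>
      [/\ is_gpath p, is_gpath q, ~ (gpath_null p /\ gpath_null q),
          ends_in (inf_emitter (E i)) p & ends_in (inf_emitter (F i)) q]
  end.

Definition elt_ext (m : felt) (n : elt) : Prop :=
  match m, n with
  | FD p, GD q => gpath_ext p q
  | FP true p q, GP true p' q' => gpath_ext p p' /\ gpath_ext q q'
  | FP false p q, GP false p' q' => gpath_ext p p' /\ gpath_ext q q'
  | _, _ => False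
  end.

(* [None] if the two elements have different types. *)
Definition elt_merge (m : felt) (n : elt) : option elt :=
  match m, n with
  | FD p, GD q => Some (GD (gpath_cat p q))
  | FP true p q, GP true p' q' => Some (GP (gpath_cat p p') (gpath_cat q q'))
  | FP false p q, GP false p' q' => Some (GP (gpath_cat p p') (gpath_cat q q'))
  | _, _ => None
  end.

Definition felt_merge (m n : felt) : option felt :=
  match m, n with
  | FD p, FD q => Some (FD (finpath_cat p q))
  | FP true p q, FP true p' q' =>
      Some (FP (finpath_cat p p') (finpath_cat q q'))
  | FP false p q, FP false p' q' =>
      Some (FP (finpath_cat p p') (finpath_cat q q'))
  | _, _ => None
  end.

Definition linked (m : felt) (n : elt) : Prop :=
  felt_term m = elt_orig n /\ elt_type (elt_of m) <> elt_type n.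

(* [s] followed by [l] is a string of linked elements, those of [s] being
   finite path elements *)
Fixpoint linked_string (s : seq felt) (l : elt) : Prop :=
  if s is m :: s' then
    [/\ is_felt m, linked m (head l (map elt_of s')) & linked_string s' l]
  else True.

(* [FS s m] is the string [s] followed by the last element [m]. *)
Inductive fmpath :=
  | FV of Overt
  | FS of seq felt & felt.

Definition is_fmpath (mu : fmpath) : Prop :=
  match mu with
  | FV _ => True
  | FS s m => linked_string s (elt_of m) /\ is_felt m
  end.

Definition fmpath_term (mu : fmpath) : Overt :=
  match mu with FV x => x | FS _ m => felt_term m end.

(* [IS s m] is the finite string [s] followed by the last element [m], and
   [II f] an infinite string. *)
Inductive impath :=
  | IV of Overt
  | IS of seq felt & elt
  | II of nat -> felt.

Definition is_impath (x : impath) : Prop :=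
  match x with
  | IV (Oprod i y z) => inf_emitter (E i) y /\ inf_emitter (F i) z
  | IV (Oa _) => False
  | IS s m => linked_string s m /\ is_ielt m
  | II f => forall n, is_felt (f n) /\ linked (f n) (elt_of (f n.+1))
  end.

Definition impath_orig (x : impath) : Overt :=
  match x with
  | IV y => y
  | IS s m => elt_orig (head m (map elt_of s))
  | II f => elt_orig (elt_of (f 0))
  end.

(* The [k]-th path element of [x], counted from 0; for [k = size s] it is the
   default value [m] of [nth]. *)
Definition impath_elt (x : impath) (k : nat) : option elt :=
  match x with
  | IV _ => None
  | IS s m => if k <= size s then Some (nth m (map elt_of s) k) else None
  | II f => Some (elt_of (f k))
  end.

Definition fmpath_rcons (mu : fmpath) (n : felt) : fmpath :=
  match mu with
  | FV _ => FS [::] n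
  | FS s m => if felt_merge m n is Some k then FS s k else FS (rcons s m) n
  end.

Definition impath_cons (m : felt) (x : impath) : impath :=
  match x with
  | IV _ => IS [::] (elt_of m)
  | IS [::] l => if elt_merge m l is Some k then IS [::] k else IS [:: m] l
  | IS (n :: s) l =>
      if felt_merge m n is Some k then IS (k :: s) l else IS [:: m, n & s] l
  | II f =>
      if felt_merge m (f 0) is Some k
      then II (fun j => if j is j'.+1 then f j'.+1 else k)
      else II (fun j => if j is j'.+1 then f j' else m)
  end.

(* The concatenation [mu x]; consecutive elements of [mu] have different
   types, so only its last element can be merged. *)
Definition impath_cat (mu : fmpath) (x : impath) : impath :=
  match mu with
  | FV _ => x
  | FS s m => foldr impath_cons x (rcons s m)
  end.

Definition felt_len (m : felt) : nat * nat :=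
  match m with
  | FD p => (finpath_len p, finpath_len p)
  | FP i p q => (finpath_len p, finpath_len q)
  end.

Definition fmpath_len (mu : fmpath) : nat * nat :=
  match mu with
  | FV _ => (0, 0)
  | FS s m => (\sum_(n <- rcons s m) (felt_len n).1,
               \sum_(n <- rcons s m) (felt_len n).2)
  end.

Definition pathspace : Type := {x : impath | is_impath x}.

HB.instance Definition _ := gen_eqMixin pathspace.
HB.instance Definition _ := gen_choiceMixin pathspace.

Definition Zset (mu : fmpath) : set pathspace :=
  match mu with
  | FV y => [set x | impath_orig (sval x) = y]
  | FS s m => [set x |
      (forall k, k < size s ->
         impath_elt (sval x) k = Some (elt_of (nth m s k))) /\
      (exists2 n, impath_elt (sval x) (size s) = Some n & elt_ext m n)]
  end.

Definition D_felt (e : D_edge) : felt := FD (D_orig e, [:: (e : edge Dgraph)]).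

Definition Vset (mu : fmpath) : set pathspace :=
  [set x | Zset mu x /\
     forall i, fmpath_term mu = Ou i ->
       ~ (Zset (fmpath_rcons mu (D_felt (Dalpha i))) `|`
          Zset (fmpath_rcons mu (D_felt (Depsilon i)))) x].

(* [Vset_minus mu B C] is V(mu; B, C) when [fmpath_term mu = Oprod y z]. *)
Definition Vset_minus (mu : fmpath) (i : bool) (y : vert (E i)) (z : vert (F i))
    (B : set (edge (E i))) (C : set (edge (F i))) : set pathspace :=
  Vset mu `\`
    (\bigcup_(e in B) Zset (fmpath_rcons mu (FP (y, [:: e]) (z, [::]))) `|`
     \bigcup_(f in C) Zset (fmpath_rcons mu (FP (y, [::]) (z, [:: f])))).

Definition admissible (G : digraph) (y : vert G) (B : set (edge G)) : Prop :=
  [/\ finite_set B, B `<=` [set e | orig e = y]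
    & ~ inf_emitter G y -> B = set0].

Definition pathspace_base : set (set pathspace) :=
  [set W | exists2 mu, is_fmpath mu & W = Zset mu] `|`
  [set W | exists mu i (y : vert (E i)) (z : vert (F i)) B C,
     [/\ is_fmpath mu, fmpath_term mu = Oprod y z, admissible y B,
         admissible z C & W = Vset_minus mu y z B C]].

(* This family is in fact a base; since a base is also a subbase of the topology
   it spans, generating from a subbase yields that topology without requiring
   the base property here. The same applies to [groupoid_base]. *)
HB.instance Definition _ :=
  @isSubBaseTopological.Build pathspace (set pathspace) pathspace_base id.

Definition deg (mu nu : fmpath) : int * int :=
  (((fmpath_len mu).1%:Z - (fmpath_len nu).1%:Z)%R,
   ((fmpath_len mu).2%:Z - (fmpath_len nu).2%:Z)%R).

(* [(x, n, y) = (mu z, l(mu) - l(nu), nu z)], both concatenations being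
   defined *)
Definition triple_of (mu nu : fmpath) (z : pathspace)
    (g : pathspace * (int * int) * pathspace) : Prop :=
  [/\ fmpath_term mu = impath_orig (sval z),
      fmpath_term nu = impath_orig (sval z),
      sval g.1.1 = impath_cat mu (sval z),
      sval g.2 = impath_cat nu (sval z) & g.1.2 = deg mu nu].

Definition spielberg_groupoid : Type :=
  {g : pathspace * (int * int) * pathspace |
    exists mu nu z, [/\ is_fmpath mu, is_fmpath nu & triple_of mu nu z g]}.

HB.instance Definition _ := gen_eqMixin spielberg_groupoid.
HB.instance Definition _ := gen_choiceMixin spielberg_groupoid.

(* The product being [(x, n, y) (y, m, z) = (x, n + m, z)], the unit
   [(x, 0, x)] is identified with [x]. *)
Definition grange (g : spielberg_groupoid) : pathspace := (sval g).1.1.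
Definition gsource (g : spielberg_groupoid) : pathspace := (sval g).2.

(* The elements [(mu1 z, l(mu1) - l(mu2), mu2 z)] with [mu1 z] in [W1] and
   [mu2 z] in [W2]. *)
Definition bisection (mu1 mu2 : fmpath) (W1 W2 : set pathspace) :
    set spielberg_groupoid :=
  [set g | [/\ exists z, triple_of mu1 mu2 z (sval g),
               W1 (grange g) & W2 (gsource g)]].

Definition groupoid_base : set (set spielberg_groupoid) :=
  [set W | exists mu1 mu2,
     [/\ is_fmpath mu1, is_fmpath mu2, fmpath_term mu1 = fmpath_term mu2
       & W = bisection mu1 mu2 (Zset mu1) (Zset mu2)]] `|`
  [set W | exists mu1 mu2 i (y : vert (E i)) (z : vert (F i)) B C,
     [/\ is_fmpath mu1 /\ is_fmpath mu2,
         fmpath_term mu1 = Oprod y z /\ fmpath_term mu2 = Oprod y z,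
         admissible y B, admissible z C
       & W = bisection mu1 mu2 (Vset_minus mu1 y z B C)
               (Vset_minus mu2 y z B C)]].

HB.instance Definition _ :=
  @isSubBaseTopological.Build spielberg_groupoid (set spielberg_groupoid)
    groupoid_base id.

End MixedGraph.

Arguments Overt : clear implicits.
Arguments felt : clear implicits.
Arguments elt : clear implicits.
Arguments fmpath : clear implicits.
Arguments impath : clear implicits.

(* Main.v *)
Require Import Defs.
From mathcomp Require Import all_boot all_order all_algebra finmap zify.
From mathcomp Require Import boolp classical_sets functions cardinality.
From mathcomp Require Import topology.

Set Implicit Arguments.
Unset Strict Implicit.
Unset Printing Implicit Defensive.

Local Open Scope classical_set_scope.

(** A finite path [nu] gives the homeomorphism [z |-> nu z] from [Z(t(nu))] onto
    [Z(nu)], hence the bisection [U(t(nu), nu)] with range [Z(t(nu))] and source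
    [Z(nu)].  The sets [Z(a)], [a] a vertex, cover the unit space, so a family of
    paths [nu_a] with [t(nu_a) = a] and pairwise disjoint [Z(nu_a)] yields, as the
    union of these bisections, an [s]-section whose range is the whole space.
    Every nonempty open set contains some [Z(nu)], and [nu] can be continued to
    [a_0], then by [beta_0^N gamma_0], then to any vertex; different [N] give
    disjoint sets.  As there are countably many vertices, the even and the odd
    values of [N] provide two such families with disjoint sources. *)

(** There may be infinitely many vertices, so a section with full range is glued from infinitely
    many bisections; disjoint sources keep the source map injective on their union. The words
    beta_0^N gamma_0 serve because none is a prefix of another, whereas the powers of one loop would
    give nested cylinders. The real work concerns the cylinders Z(mu). Concatenation merges adjacent
    elements of one type, and an element of E_i x F_i has two independent coordinates, so cylinders
    may overlap without being nested; hence laws for paths are proved by prepending one element m at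
    a time, and the preimage of a cylinder under z |-> m z is computed explicitly. Cylinders turn
    out to be closed, thanks to the sets V(mu; B, C), so continuity of z |-> mu z can be tested on
    them. For continuity of the inverse of the source map, a generating bisection U(mu_1, mu_2) that
    meets the piece of nu must satisfy mu_2 = nu mu_1; this comes from the degree in N^2, which
    determines an initial piece of a given path. Both topologies are given by generating families
    only, so neighbourhoods are compared by means of filters. *)

Lemma cat_cancel (T : Type) (s t t' : seq T) : s ++ t = s ++ t' -> t = t'.
Proof. by move/(congr1 (drop (size s))); rewrite !drop_size_cat. Qed.

(** * Prefixes, concatenation and residuals of directed paths *)

Section Gpaths.
Context {G : digraph}.
Implicit Types (p q l r : finpath G) (g : gpath G) (es : seq (edge G)).

(** Truncation makes sense alike for finite and infinite paths: extension becomes one equation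
    ([gpath_extE]), and truncating a concatenation a computation ([gtake_cat]). *)
Definition gtake g n : seq (edge G) :=
  match g with Fin q => take n q.2 | Inf f => mkseq f n end.

Definition null_at (y : vert G) : finpath G := (y, [::]).

Lemma walk_cat y es es' :
  walk y (es ++ es') <-> walk y es /\ walk (last y (map (@term G) es)) es'.
Proof.
elim: es y => [|e es IH] y /=; first by split=> [|[]].
by rewrite IH; split=> [[-> []]|[[-> ?] ?]].
Qed.

Lemma walk_nth e0 y es n : walk y es -> n.+1 < size es ->
  term (nth e0 es n) = orig (nth e0 es n.+1).
Proof.
elim: es y n => [//|e [//|e' es] IH] y [|n] /= [_ W] lt_n; first by case: W.
exact: (IH _ _ W).
Qed.

Lemma finpath_term_cat p q :
  q.1 = finpath_term p -> finpath_term (finpath_cat p q) = finpath_term q.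
Proof. by rewrite /finpath_term /= map_cat last_cat => ->. Qed.

Lemma is_finpath_cat p q : is_finpath p -> is_finpath q ->
  q.1 = finpath_term p -> is_finpath (finpath_cat p q).
Proof. by rewrite /is_finpath /= => Wp Wq qp; apply/walk_cat;
  rewrite -[last _ _]qp. Qed.

Lemma finpath_cat_null p y : finpath_cat p (y, [::]) = p.
Proof. by case: p => z es; rewrite /finpath_cat /= cats0. Qed.

Lemma gtake0 g : gtake g 0 = [::].
Proof. by case: g => [q|f] //=; rewrite take0. Qed.

Lemma gpath_extE p g :
  gpath_ext p g <-> p.1 = gpath_orig g /\ p.2 = gtake g (size p.2).
Proof.
case: g => [q|f] //=; split=> -[-> H]; split=> //.
  by case: H => es ->; rewrite take_size_cat.
by exists (drop (size p.2) q.2); rewrite {1}H cat_take_drop.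
Qed.

Lemma gtake_cat p g n :
  gtake (gpath_cat p g) n = take n p.2 ++ gtake g (n - size p.2).
Proof.
case: g => [q|f] /=.
  by rewrite take_cat; case: ltnP => // H; rewrite ?(take_oversize H)//;
     move: (ltnW H); rewrite -subn_eq0 => /eqP ->; rewrite take0 cats0.
apply: (@eq_from_nth _ (f 0)) => [|k].
  by rewrite size_cat !size_mkseq size_take_min minnE subnK// leq_subr.
rewrite size_mkseq => lt_k; rewrite nth_mkseq// nth_cat size_take_min leq_min lt_k /=.
case: ltnP => [lt_kp|le_pk]; first by rewrite nth_take.
rewrite (minn_idPr _) ?nth_mkseq//; last exact: leq_trans (ltnW lt_k).
by rewrite ltn_sub2r// (leq_ltn_trans le_pk).
Qed.

Lemma gpath_catA p q g :
  gpath_cat (finpath_cat p q) g = gpath_cat p (gpath_cat q g).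
Proof.
case: g => [r|f] /=; first by rewrite /finpath_cat /= catA.
congr Inf; apply/funext => n; rewrite size_cat nth_cat subnDA.
case: (ltnP n (size p.2)) => [lt_n|le_n].
  by rewrite ltn_addr// (set_nth_default (f 0)).
by rewrite ltn_subLR.
Qed.

Lemma gpath_cat_null p : gpath_cat p (Fin (null_at (finpath_term p))) = Fin p.
Proof. by rewrite /= finpath_cat_null. Qed.

Lemma gpath_orig_cat p g : is_finpath p -> gpath_orig g = finpath_term p ->
  gpath_orig (gpath_cat p g) = p.1.
Proof.
case: p => y [|e es]; case: g => [q|f] //=.
by case.
Qed.

Lemma is_gpath_cat p g : is_finpath p -> is_gpath g ->
  gpath_orig g = finpath_term p -> is_gpath (gpath_cat p g).
Proof.
case: g => [q|f] /= Wp Wg gp; first exact: is_finpath_cat.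
move=> n; case: (ltngtP n.+1 (size p.2)) => [lt_n|lt_n|En].
- exact: walk_nth Wp lt_n.
-by rewrite subSn.
- rewrite En subnn gp /finpath_term (last_nth p.1) size_map -En /=.
 by rewrite (nth_map (f 0)) -?En.
Qed.

Lemma ends_in_cat S p g : gpath_orig g = finpath_term p ->
  ends_in S (gpath_cat p g) <-> ends_in S g.
Proof. by case: g => [q|f] //= ?; rewrite finpath_term_cat. Qed.

Lemma gpath_null_cat p g :
  gpath_null (gpath_cat p g) <-> finpath_len p = 0 /\ gpath_null g.
Proof.
case: g => [q|f] /=; last by split=> // -[].
rewrite /finpath_len size_cat; split; last by case=> -> ->.
by move/eqP; rewrite addn_eq0 => /andP[/eqP -> /eqP ->].
Qed.

Lemma gpath_null_inj g : gpath_null g -> g = Fin (null_at (gpath_orig g)).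
Proof. by case: g => [[y []]|]. Qed.

Lemma gpath_cat_inj p g g' : gpath_orig g = gpath_orig g' ->
  gpath_cat p g = gpath_cat p g' -> g = g'.
Proof.
case: g g' => [q|f] [q'|f'] //=.
  case: q q' => [y es] [y' es'] /= -> [].
  by move/cat_cancel => ->.
move=> _ [] H; congr Inf; apply/funext => n.
by move: (congr1 (fun h => h (size p.2 + n)) H);
  rewrite /= ltnNge leq_addr /= addKn.
Qed.

Lemma gpath_ext_orig p g : gpath_ext p g -> gpath_orig g = p.1.
Proof. by case/gpath_extE. Qed.

Lemma gpath_ext_null y g : gpath_ext (null_at y) g <-> gpath_orig g = y.
Proof. by rewrite gpath_extE gtake0; split=> [[]|]. Qed.

Lemma gpath_ext_cat p g : is_finpath p -> gpath_orig g = finpath_term p ->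
  gpath_ext p (gpath_cat p g).
Proof.
move=> Wp gp; apply/gpath_extE; rewrite gpath_orig_cat// gtake_cat.
by rewrite take_size subnn gtake0 cats0.
Qed.

Lemma gpath_ext_cancel p l g : is_finpath p -> l.1 = finpath_term p ->
  gpath_orig g = finpath_term p ->
  gpath_ext (finpath_cat p l) (gpath_cat p g) <-> gpath_ext l g.
Proof.
move=> Wp lp gp; rewrite !gpath_extE /= gpath_orig_cat// gtake_cat size_cat.
rewrite addKn take_oversize ?leq_addr// lp gp; split=> -[_ H]; split=> //.
  exact: cat_cancel H.
by rewrite -H.
Qed.

Lemma last_term_mkseq y (f : nat -> edge G) k :
  last y (map (@term G) (mkseq f k.+1)) = term (f k).
Proof. by rewrite mkseqS map_rcons last_rcons. Qed.

Lemma gpath_ext_div p g : is_gpath g -> gpath_ext p g ->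
  exists g', [/\ is_gpath g', gpath_orig g' = finpath_term p & g = gpath_cat p g'].
Proof.
case: g => [q|f] /= Wg.
  case=> pq [es Eq]; exists (Fin (finpath_term p, es)); split=> //=.
    by move: Wg; rewrite /is_finpath Eq -pq => /walk_cat[].
  by case: q {Wg} pq Eq => y s /= <- ->.
case=> p1 Ep; exists (Inf (fun n => f (size p.2 + n))); split=> [n||] /=.
- by rewrite Wg addnS.
- rewrite addn0 /finpath_term Ep p1 size_mkseq; case: (size p.2) => [//|k].
  by rewrite last_term_mkseq Wg.
- congr Inf; apply/funext=> n; case: ltnP => [lt_n|/subnKC -> //].
  by rewrite Ep nth_mkseq.
Qed.

Lemma gpath_ext_uniq p p' g : gpath_ext p g -> gpath_ext p' g ->
  size p.2 = size p'.2 -> p = p'.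
Proof.
case: p p' => [y s] [y' s']; rewrite !gpath_extE /= => -[-> Es] [-> Es'] E.
by congr pair; rewrite Es E -Es'.
Qed.

Lemma is_finpath_ext p g : is_gpath g -> gpath_ext p g -> is_finpath p.
Proof.
case: g => [q|f] /= Wg; case=> p1 Ep.
  by case: Ep => es Ep; move: Wg; rewrite /is_finpath p1 Ep => /walk_cat[].
rewrite /is_finpath p1 Ep; elim: (size p.2) => [//|k IH].
rewrite mkseqS -cats1; apply/walk_cat; split=> //=; split=> //.
by case: k {IH} => [//|k]; rewrite last_term_mkseq Wg.
Qed.

(** If l is no longer than p, the condition on p g does not involve g beyond its origin: it holds
    always ([r] is null) or never. If l is longer, it must begin with p, and [r] is what remains of
    it. *)
Lemma gpath_ext_residual l p : is_finpath l -> is_finpath p ->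
  (forall g, gpath_orig g = finpath_term p -> ~ gpath_ext l (gpath_cat p g)) \/
  exists r, [/\ is_finpath r, r.1 = finpath_term p &
    forall g, gpath_orig g = finpath_term p ->
      gpath_ext l (gpath_cat p g) <-> gpath_ext r g].
Proof.
move=> Wl Wp.
have ext g : gpath_orig g = finpath_term p -> gpath_ext l (gpath_cat p g) <->
    l.1 = p.1 /\ l.2 = take (size l.2) p.2 ++ gtake g (size l.2 - size p.2).
  by move=> gp; rewrite gpath_extE gpath_orig_cat// gtake_cat.
have [lp1|lp1] := pselect (l.1 = p.1); last first.
  by left=> g gp /(ext _ gp)[].
have [le_lp|lt_pl] := leqP (size l.2) (size p.2).
  have [El|El] := pselect (l.2 = take (size l.2) p.2).
    right; exists (null_at (finpath_term p)); split=> // g gp.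
    rewrite ext// gpath_ext_null gp; split=> // _; split=> //.
    by move/eqP: le_lp => ->; rewrite gtake0 cats0.
  left=> g gp /(ext _ gp)[_]; move/eqP: le_lp => ->; rewrite gtake0 cats0.
  exact: El.
have [Ep|Ep] := pselect (p.2 = take (size p.2) l.2); last first.
  left=> g gp /(ext _ gp)[_]; rewrite (take_oversize (ltnW lt_pl)) => El.
  by apply: Ep; rewrite El take_size_cat.
right; exists (finpath_term p, drop (size p.2) l.2); split=> //.
  move: Wl; rewrite /is_finpath -{1}(cat_take_drop (size p.2) l.2) -Ep lp1.
  by case/walk_cat.
move=> g gp; rewrite ext// gpath_extE /= gp (take_oversize (ltnW lt_pl)).
rewrite size_drop lp1; split=> -[_ El]; split=> //.
  by rewrite {1}El drop_size_cat.
by rewrite -El {1}Ep cat_take_drop.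
Qed.

End Gpaths.

(** * Path elements: merging, extension and division *)

Section PathElements.
Context {E F : bool -> digraph}.
Variables (v : forall i, vert (E i)) (w : forall i, vert (F i)).
Implicit Types (m n : felt E F) (l k : elt E F).

Local Notation fterm := (felt_term v w).
Local Notation eorig := (elt_orig v w).

(** Once [i] is a constant, a projection with a default value can be typed, and it gives injectivity
    of the dependent constructor. [GP_inj] is obtained in the same way. *)
Lemma Oprod_inj i (y y' : vert (E i)) (z z' : vert (F i)) :
  Oprod y z = Oprod y' z' -> y = y' /\ z = z'.
Proof.
case: i y y' z z' => y y' z z' H; split.
- exact: (congr1 (fun x : Overt E F => if x is Oprod true a _ then a else y) H).
- exact: (congr1 (fun x : Overt E F => if x is Oprod true _ a then a else z) H).
- exact: (congr1 (fun x : Overt E F => if x is Oprod false a _ then a else y) H).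
- exact: (congr1 (fun x : Overt E F => if x is Oprod false _ a then a else z) H).
Qed.

Definition Overt_index (x : Overt E F) : bool :=
  match x with Oprod i _ _ => i | Oa i => i end.

Lemma Overt_of_D_inj x y : Overt_of_D v w x = Overt_of_D v w y -> x = y.
Proof.
by case: x y => i [] j //= H; move: (congr1 Overt_index H) => /= ->.
Qed.

(** The common part of [is_felt] and [is_ielt] (see [is_feltE], [is_ieltE]). Infinite elements add
    only the condition [elt_ends] on the terminus, so merging is treated once for both kinds. *)
Definition is_gelt l : Prop :=
  match l with
  | GD p => is_gpath p /\ ~ gpath_null p
  | GP i p q =>
      [/\ is_gpath p, is_gpath q & ~ (gpath_null p /\ gpath_null q)]
  end.

Definition elt_ends l : Prop :=
  match l with
  | GD p => ends_in (range Du : set (vert Dgraph)) p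
  | GP i p q => ends_in (inf_emitter (E i)) p /\ ends_in (inf_emitter (F i)) q
  end.

Lemma is_ieltE l : is_ielt l <-> is_gelt l /\ elt_ends l.
Proof.
case: l => [p|i p q] /=; first by split=> [[]|[[]]].
by split=> [[]|[[? ? ?] []]].
Qed.

Lemma GP_inj i (g g' : gpath (E i)) (h h' : gpath (F i)) :
  GP g h = GP g' h' -> g = g' /\ h = h'.
Proof.
case: i g g' h h' => g g' h h' H.
  pose f l := if l is @GP _ _ true a b then (a, b) else (g, h).
  by case: (congr1 f H).
pose f l := if l is @GP _ _ false a b then (a, b) else (g, h).
by case: (congr1 f H).
Qed.

Lemma is_feltE m : is_felt m <-> is_gelt (elt_of m).
Proof.
case: m => [p|i p q] /=; rewrite /finpath_len.
  by split=> -[Wp]; [case: size|move/eqP; rewrite lt0n].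
split=> -[Wp Wq H]; split=> //; first by case=> p0 q0; move: H; rewrite p0 q0 => -[].
case: (posnP (size p.2)) => [p0|]; [right|by left].
by case: (posnP (size q.2)) => // q0; case: H.
Qed.

Lemma elt_of_inj m n : elt_of m = elt_of n -> m = n.
Proof.
case: m n => [p|[] p q] [p'|[] p' q'] //= H.
- by case: H => ->.
- by case/GP_inj: H => -[->] [->].
- by case/GP_inj: H => -[->] [->].
Qed.

Lemma elt_mergeP i p q (g : gpath (E i)) (h : gpath (F i)) :
  elt_merge (FP p q) (GP g h) = Some (GP (gpath_cat p g) (gpath_cat q h)).
Proof. by case: i p q g h. Qed.

Lemma elt_extP i p q (g : gpath (E i)) (h : gpath (F i)) :
  elt_ext (FP p q) (GP g h) = (gpath_ext p g /\ gpath_ext q h).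
Proof. by case: i p q g h. Qed.

(** Equality of types in inductive form: destructing it unifies the indices of the two elements, on
    which the types of their paths depend. *)
Inductive same_type : felt E F -> elt E F -> Prop :=
  | SameD p g : same_type (FD p) (GD g)
  | SameP i (p : finpath (E i)) (q : finpath (F i))
      (g : gpath (E i)) (h : gpath (F i)) : same_type (FP p q) (GP g h).

Lemma same_typeP m l : elt_type (elt_of m) = elt_type l -> same_type m l.
Proof.
case: m l => [p|i p q] [g|j g h] //= H; first by constructor.
by have ij : i = j; [case: H | subst j; constructor].
Qed.

Lemma elt_merge_none m l :
  elt_merge m l = None <-> elt_type (elt_of m) <> elt_type l.
Proof.
split; last by case: m l => [p|[] p q] [g|[] g h] //= [].
by move=> + H; destruct (same_typeP H) => //; rewrite elt_mergeP.
Qed.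

Variant elt_merge_spec : felt E F -> elt E F -> elt E F -> Prop :=
  | MergeD p g : elt_merge_spec (FD p) (GD g) (GD (gpath_cat p g))
  | MergeP i (p : finpath (E i)) (q : finpath (F i))
      (g : gpath (E i)) (h : gpath (F i)) :
      elt_merge_spec (FP p q) (GP g h)
        (GP (gpath_cat p g) (gpath_cat q h)).

Lemma elt_merge_some m l k : elt_merge m l = Some k -> elt_merge_spec m l k.
Proof. by case: m l => [p|[] p q] [g|[] g h] //= [] <-; constructor. Qed.

Lemma elt_merge_type m l k : elt_merge m l = Some k ->
  elt_type (elt_of m) = elt_type l /\ elt_type k = elt_type l.
Proof. by move/elt_merge_some; case. Qed.

Lemma elt_merge_of m n :
  elt_merge m (elt_of n) = omap (@elt_of E F) (felt_merge m n).
Proof. by case: m n => [p|[] p q] [p'|[] p' q']. Qed.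

Lemma felt_merge_some m n (k : felt E F) : felt_merge m n = Some k ->
  elt_merge m (elt_of n) = Some (elt_of k).
Proof. by rewrite elt_merge_of => ->. Qed.

Lemma felt_merge_none m n : felt_merge m n = None ->
  elt_merge m (elt_of n) = None.
Proof. by rewrite elt_merge_of => ->. Qed.

Lemma elt_mergeA m n (k : felt E F) l : felt_merge m n = Some k ->
  elt_merge k l = obind (elt_merge m) (elt_merge n l).
Proof.
by case: m n => [p|[] p q] [p'|[] p' q'] //= [] <- {k}; case: l => [g|[] g h] //=;
  rewrite !gpath_catA.
Qed.

Lemma felt_mergeA m n (k m' : felt E F) : felt_merge m n = Some k ->
  felt_merge k m' = obind (felt_merge m) (felt_merge n m').
Proof.
by case: m n => [p|[] p q] [p'|[] p' q'] //= [] <- {k}; case: m' => [g|[] g h] //=;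
  rewrite /finpath_cat /= !catA.
Qed.

Lemma link_D p (g : gpath Dgraph) : fterm (FD p) = eorig (GD g) ->
  gpath_orig g = finpath_term p.
Proof. by move/Overt_of_D_inj. Qed.

Lemma link_P i (p : finpath (E i)) (q : finpath (F i))
    (g : gpath (E i)) (h : gpath (F i)) :
  fterm (FP p q) = eorig (GP g h) ->
  gpath_orig g = finpath_term p /\ gpath_orig h = finpath_term q.
Proof. by case/Oprod_inj => -> ->. Qed.

Lemma elt_orig_merge m l k : is_felt m -> fterm m = eorig l ->
  elt_merge m l = Some k -> eorig k = eorig (elt_of m).
Proof.
move=> + + /elt_merge_some H; case: m l k / H => [p g|i p q g h].
  by case=> Wp _ /link_D gp /=; rewrite gpath_orig_cat.
by case=> Wp Wq _ /link_P[gp hq] /=; rewrite !gpath_orig_cat.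
Qed.

Lemma felt_term_merge m n (k : felt E F) : fterm m = eorig (elt_of n) ->
  felt_merge m n = Some k -> fterm k = fterm n.
Proof.
move=> + /felt_merge_some; case: m n => [p|[] p q] [p'|[] p' q'] //=.
- by move/Overt_of_D_inj => H [] /(@elt_of_inj (FD _)) <- /=; rewrite finpath_term_cat.
- case/Oprod_inj => H H' [] /(@elt_of_inj (@FP _ _ true _ _)) <- /=.
  by rewrite !finpath_term_cat.
- case/Oprod_inj => H H' [] /(@elt_of_inj (@FP _ _ false _ _)) <- /=.
  by rewrite !finpath_term_cat.
Qed.

Lemma is_gelt_merge m l k : is_felt m -> is_gelt l -> fterm m = eorig l ->
  elt_merge m l = Some k -> is_gelt k.
Proof.
move=> + + + /elt_merge_some H; case: m l k / H => [p g|i p q g h].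
  move=> [Wp _] [Wg g0] /link_D gp; split; first exact: is_gpath_cat.
  by case/gpath_null_cat.
move=> [Wp Wq _] [Wg Wh gh0] /link_P[gp hq]; split; try exact: is_gpath_cat.
by case=> /gpath_null_cat[_ g0] /gpath_null_cat[_ h0]; apply: gh0.
Qed.

Lemma is_felt_merge m n (k : felt E F) : is_felt m -> is_felt n ->
  fterm m = eorig (elt_of n) ->
  felt_merge m n = Some k -> is_felt k.
Proof.
move=> Wm /is_feltE Wn mn /felt_merge_some H; apply/is_feltE.
exact: is_gelt_merge H.
Qed.

Lemma elt_ends_merge m l k : fterm m = eorig l -> elt_merge m l = Some k ->
  elt_ends k <-> elt_ends l.
Proof.
move=> + /elt_merge_some H; case: m l k / H => [p g|i p q g h].
  by move/link_D => gp; apply: ends_in_cat.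
by move/link_P => [gp hq] /=; rewrite !ends_in_cat.
Qed.

Lemma is_ielt_merge m l k : is_felt m -> is_ielt l -> fterm m = eorig l ->
  elt_merge m l = Some k -> is_ielt k.
Proof.
move=> Wm /is_ieltE[Wl endl] ml H; apply/is_ieltE; split.
  exact: is_gelt_merge H.
by rewrite elt_ends_merge; eauto.
Qed.

Lemma elt_ext_type m l : elt_ext m l -> elt_type (elt_of m) = elt_type l.
Proof. by case: m l => [p|[] p q] [g|[] g h]. Qed.

Lemma elt_ext_orig m l : elt_ext m l -> eorig l = eorig (elt_of m).
Proof.
move=> H; destruct (same_typeP (elt_ext_type H)) as [p g|i p q g h]; move: H.
  by move/gpath_ext_orig=> /= ->.
by rewrite elt_extP => -[/gpath_ext_orig /= -> /gpath_ext_orig /= ->].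
Qed.

Lemma elt_ext_refl m : elt_ext m (elt_of m).
Proof.
have refl (G : digraph) (p : finpath G) : gpath_ext p (Fin p).
  by split=> //; exists [::]; rewrite cats0.
case: m => [p|i p q]; first exact: refl.
by rewrite /elt_of elt_extP; split; exact: refl.
Qed.

Lemma elt_ext_merge m l k : is_felt m -> fterm m = eorig l ->
  elt_merge m l = Some k -> elt_ext m k.
Proof.
move=> + + /elt_merge_some H; case: m l k / H => [p g|i p q g h].
  by case=> Wp _ /link_D gp; apply: gpath_ext_cat.
case=> Wp Wq _ /link_P[gp hq]; rewrite elt_extP.
by split; apply: gpath_ext_cat.
Qed.

Lemma elt_ext_cancel m n (k : felt E F) l l' : is_felt m ->
  fterm m = eorig (elt_of n) -> fterm m = eorig l ->
  felt_merge m n = Some k -> elt_merge m l = Some l' ->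
  elt_ext k l' <-> elt_ext n l.
Proof.
move=> + + + + /elt_merge_some H; case: m l l' / H => [p g|i p q g h].
  case: n => [p'|i p' q'] //= [Wp _] /Overt_of_D_inj p'p /link_D gp [] <- /=.
  exact: gpath_ext_cancel.
case: n => [p'|j p' q']; first by move=> _ _ _; case: i p q g h.
move=> [Wp Wq _] H; have ij : i = j := congr1 Overt_index H; subst j.
case/Oprod_inj: H => p'p q'q /link_P[gp hq] Ek.
have -> : k = FP (finpath_cat p p') (finpath_cat q q').
  by case: i p q p' q' Ek {Wp Wq g h p'p q'q gp hq} => p q p' q' /= [].
by rewrite !elt_extP (gpath_ext_cancel Wp (esym p'p) gp)
  (gpath_ext_cancel Wq (esym q'q) hq).
Qed.

Lemma elt_merge_inj m l l' k : eorig l = eorig l' ->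
  elt_merge m l = Some k -> elt_merge m l' = Some k -> l = l'.
Proof.
move=> ll' H H'; have [ml _] := elt_merge_type H; have [ml' _] := elt_merge_type H'.
destruct (same_typeP ml) as [p g|i p q g h].
  case: l' ll' ml' H H' => [g'|//] /Overt_of_D_inj gg' _ /= [<-] [] /esym/gpath_cat_inj.
  by move=> ->.
case: l' ll' ml' H H' => [//|j g' h'] + ij; have {}ij : i = j by case: ij.
subst j => /Oprod_inj[gg' hh']; rewrite !elt_mergeP => -[<-]
  /Some_inj/GP_inj[/esym/gpath_cat_inj -> //].
by move/esym/gpath_cat_inj => ->.
Qed.

(** Quotients exist in each coordinate, but when all of them have length zero they do not form a
    path element; this is the first alternative. *)
Lemma elt_ext_div m k : is_felt m -> is_gelt k -> elt_ext m k ->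
  k = elt_of m \/
  exists l, [/\ is_gelt l, fterm m = eorig l & elt_merge m l = Some k].
Proof.
move=> + + H; destruct (same_typeP (elt_ext_type H)) as [p k|i p q k k']; move: H.
  move=> pk [Wp p0] [Wk k0]; have [g [Wg gp Ek]] := gpath_ext_div Wk pk.
  have [g0|g0] := pselect (gpath_null g).
    by left; rewrite Ek (gpath_null_inj g0) gp gpath_cat_null.
  by right; exists (GD g); split=> //=; rewrite ?gp// Ek.
rewrite elt_extP => -[pk qk'] [Wp Wq pq0] [Wk Wk' kk0].
have [g [Wg gp Ek]] := gpath_ext_div Wk pk.
have [h [Wh hq Ek']] := gpath_ext_div Wk' qk'.
have [[g0 h0]|gh0] := pselect (gpath_null g /\ gpath_null h).
  by left; rewrite Ek Ek' (gpath_null_inj g0) gp (gpath_null_inj h0) hq !gpath_cat_null.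
right; exists (GP g h); split=> //; first by rewrite /= gp hq.
by rewrite elt_mergeP Ek Ek'.
Qed.

(** A path element has positive length, so merging lengthens [m]. This rules out mixed cases below,
    where [m] merges on one side of an equation and stays a separate element on the other. *)
Lemma elt_merge_neq m l : is_gelt l -> elt_merge m l <> Some (elt_of m).
Proof.
move=> Wl H; have [ml _] := elt_merge_type H.
have null (G : digraph) (p : finpath G) g : gpath_cat p g = Fin p -> gpath_null g.
  case: g => [q|//] /= [] /(congr1 (size \o snd)) /= /eqP.
  by rewrite size_cat -{2}(addn0 (size _)) eqn_add2l => /eqP.
destruct (same_typeP ml) as [p g|i p q g h]; move: Wl H.
  by move=> [_ g0] [] /null.
case=> _ _ gh0; rewrite elt_mergeP => /Some_inj/GP_inj[/null g0 /null h0].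
exact: gh0.
Qed.

Lemma elt_merge_fin m l (k : felt E F) : elt_merge m l = Some (elt_of k) ->
  exists2 n, l = elt_of n & felt_merge m n = Some k.
Proof.
have fin (G : digraph) (p q : finpath G) g : gpath_cat p g = Fin q ->
    exists r, g = Fin r.
  by case: g => [r|//] _; exists r.
move=> H; suff [n En] : exists n, l = elt_of n.
  exists n => //; move: H; rewrite En elt_merge_of; case: felt_merge => //= n' [].
  by move/elt_of_inj => ->.
have [ml _] := elt_merge_type H.
destruct (same_typeP ml) as [p g|i p q g h]; move: H.
  by case: k => [p'|//] /= [] /fin[r ->]; exists (FD r).
rewrite elt_mergeP => /Some_inj; case: k => [//|j p' q' H].
have ij : i = j by case: H.
subst j; case/GP_inj: H => /fin[r ->] /fin[s ->].
by exists (FP r s).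
Qed.

End PathElements.

(** * Prepending one path element to an infinite path *)

Section Paths.
Context {E F : bool -> digraph}.
Variables (v : forall i, vert (E i)) (w : forall i, vert (F i)).
Hypotheses (hv : forall i, inf_emitter (E i) (v i))
  (hw : forall i, inf_emitter (F i) (w i)).
Implicit Types (m n : felt E F) (l k : elt E F) (s : seq (felt E F)).
Implicit Types (mu nu lam : fmpath E F) (x y z : impath E F).

Local Notation fterm := (felt_term v w).
Local Notation eorig := (elt_orig v w).
Local Notation iorig := (impath_orig v w).

Definition fmpath_orig mu : Overt E F :=
  match mu with FV a => a | FS s m => eorig (elt_of (head m s)) end.

(** Finite counterpart of [impath_cons], with the same merging rule, so that [fmpath_cat] is the
    same fold as [impath_cat] and prepending becomes the unit of induction for both. *)
Definition fmpath_cons m mu : fmpath E F :=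
  match mu with
  | FV _ => FS [::] m
  | FS [::] l => if felt_merge m l is Some k then FS [::] k else FS [:: m] l
  | FS (n :: s) l =>
      if felt_merge m n is Some k then FS (k :: s) l else FS [:: m, n & s] l
  end.

Definition fmpath_elts mu : seq (felt E F) :=
  match mu with FV _ => [::] | FS s m => rcons s m end.

Definition fmpath_cat mu nu : fmpath E F := foldr fmpath_cons nu (fmpath_elts mu).

(** A finite element may close an infinite path exactly when the vertex it reaches is itself an
    infinite path. For type D this rests on u_i = (v_i, w_i) lying in L_i x M_i, while a_i never
    qualifies. *)
Lemma elt_ends_term m : elt_ends (elt_of m) <-> is_impath v w (IV (fterm m)).
Proof.
case: m => [p|i p q] //=; case: (finpath_term p) => i /=; split=> //.
- by move=> _; exists i.
- by case=> j.
Qed.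

Lemma linked_merge m n (k : felt E F) l : fterm m = eorig (elt_of n) ->
  felt_merge m n = Some k -> linked v w n l <-> linked v w k l.
Proof.
move=> mn H; rewrite /linked (felt_term_merge mn H).
by have [_ ->] := elt_merge_type (felt_merge_some H).
Qed.

Lemma is_impath_cons m x : is_felt m -> is_impath v w x -> iorig x = fterm m ->
  is_impath v w (impath_cons m x) /\ iorig (impath_cons m x) = eorig (elt_of m).
Proof.
move=> Wm; case: x => [a|[|n s] l|f].
- move=> Wa /= am; split=> //; split=> //; apply/is_ieltE; split; first exact/is_feltE.
  by apply/elt_ends_term; rewrite -am.
- move=> [_ Wl] /= /esym ml; case H: elt_merge => [k|] /=.
    rewrite (elt_orig_merge Wm ml H); split=> //; split=> //.
    exact: (is_ielt_merge Wm Wl ml H).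
  by split=> //; split=> //; split=> //; split=> //; apply/elt_merge_none.
- move=> [[Wn nl Ws] Wl] /= /esym mn; case H: felt_merge => [k|] /=.
    rewrite (elt_orig_merge Wm mn (felt_merge_some H)); split=> //; split=> //.
    by split=> //; [exact: (is_felt_merge Wm Wn mn H)|apply/(linked_merge _ mn H)].
  split=> //; split=> //; split=> //; split=> //.
  exact/elt_merge_none/felt_merge_none.
- move=> Wf /= /esym mn; have [W0 L0] := Wf 0.
  case H: felt_merge => [k|] /=.
    rewrite (elt_orig_merge Wm mn (felt_merge_some H)); split=> // -[|j] //.
    by split; [exact: (is_felt_merge Wm W0 mn H)|apply/(linked_merge _ mn H)].
  split=> // -[|j] //; split=> //; split=> //.
  exact/elt_merge_none/felt_merge_none.
Qed.

(** One formula for all shapes of [x]: only a vertex lacks an element of index 0, and only that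
    element can merge. *)
Lemma impath_elt_cons m x j : impath_elt (impath_cons m x) j =
  if impath_elt x 0 is Some l then
    if elt_merge m l is Some k
    then (if j is j'.+1 then impath_elt x j else Some k)
    else (if j is j'.+1 then impath_elt x j' else Some (elt_of m))
  else if j is 0 then Some (elt_of m) else None.
Proof.
case: x => [a|[|n s] l|f] /=.
- by case: j => [|[]].
- by case: elt_merge => [k|]; case: j => [|[]].
- by rewrite elt_merge_of; case: felt_merge => [k|] /=; case: j => [|[]].
- by rewrite elt_merge_of; case: felt_merge => [k|] /=; case: j => [|[]].
Qed.

Lemma linked_string_felt s l : linked_string v w s l ->
  forall j, j < size s -> exists2 n, nth l (map (@elt_of E F) s) j = elt_of n
    & is_felt n.
Proof.
elim: s => [//|n s IH] [Wn _ Ws] [|j] /= lt_j; first by exists n.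
exact: IH.
Qed.

Lemma is_gelt_impath_elt x j l : is_impath v w x -> impath_elt x j = Some l ->
  is_gelt l.
Proof.
case: x => [a|s k|f] //=.
- case=> Ws Wk; case: ltngtP => // [lt_j|->] [<-].
    by have [n -> Wn] := linked_string_felt Ws lt_j; apply/is_feltE.
  by rewrite nth_default ?size_map//; case/is_ieltE: Wk.
- by move=> Wf [<-]; apply/is_feltE; case: (Wf j).
Qed.

Lemma impath_elt0_orig x l : impath_elt x 0 = Some l -> eorig l = iorig x.
Proof. by case: x => [a|[|n s] k|f] //= [<-]. Qed.

(** The origin matters only for vertices, whose sequence of elements is empty. A finite string
    differs from an infinite one at the index just after its last element. *)
Lemma impath_eq x y : iorig x = iorig y -> impath_elt x =1 impath_elt y -> x = y.
Proof.
have IS_II s l f : impath_elt (IS s l) =1 impath_elt (II f) -> False.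
  by move/(_ (size s).+1); rewrite /= ltnn.
case: x y => [a|s l|f] [b|s' l'|g] /= xy.
- by rewrite xy.
- by move/(_ 0).
- by move/(_ 0).
- by move/(_ 0).
- move=> H; elim: s s' {xy} H => [|n s IH] [|n' s'] H.
  + by case: (H 0) => ->.
  + by have := H 1.
  + by have := H 1.
  + have [/elt_of_inj ->] := H 0.
    by have [] := IH s' (fun j => H j.+1) => -> ->.
- by move/IS_II.
- by move/(_ 0).
- by move/fsym/IS_II.
- by move=> H; congr II; apply/funext => j; case: (H j) => /elt_of_inj.
Qed.

(** If [m] merges on both sides, it cancels in the first element; if on neither, the tails agree. A
    merge on one side only would produce an element equal to [m], against [elt_merge_neq]. *)
Lemma impath_cons_inj m x y : is_impath v w x -> is_impath v w y ->
  iorig x = fterm m -> iorig y = fterm m ->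
  impath_cons m x = impath_cons m y -> x = y.
Proof.
move=> Wx Wy xm ym /(congr1 (@impath_elt E F)) H.
apply: impath_eq => [|j]; first by rewrite xm ym.
have {}H i : impath_elt (impath_cons m x) i = impath_elt (impath_cons m y) i
  by rewrite H.
have Nil z : impath_elt z 0 = None -> forall i, impath_elt z i = None.
  by case: z => [a|s l|f].
case x0 : (impath_elt x 0) => [l|]; case y0 : (impath_elt y 0) => [l'|].
- have := H 0; have := H j.+1; have := H j; rewrite !impath_elt_cons x0 y0.
  case ml: elt_merge => [k|]; case ml': elt_merge => [k'|]//=.
  + move=> + _ [kk']; case: j => [_|//]; rewrite x0 y0; congr Some.
    apply: (@elt_merge_inj _ _ v w m _ _ k) => //; last by rewrite kk'.
    by rewrite (impath_elt0_orig x0) (impath_elt0_orig y0) xm ym.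
  + move=> _ _ [km]; have := @elt_merge_neq _ _ m _ (is_gelt_impath_elt Wx x0).
    by rewrite ml km.
  + move=> _ _ [km]; have := @elt_merge_neq _ _ m _ (is_gelt_impath_elt Wy y0).
    by rewrite ml' -km.
- have := H 0; have := H 1; rewrite !impath_elt_cons x0 y0.
  case ml: elt_merge => [k|] //= _ [km].
  have := @elt_merge_neq _ _ m _ (is_gelt_impath_elt Wx x0).
  by rewrite ml km.
- have := H 0; have := H 1; rewrite !impath_elt_cons x0 y0.
  case ml: elt_merge => [k|] //= _ [km].
  have := @elt_merge_neq _ _ m _ (is_gelt_impath_elt Wy y0).
  by rewrite ml -km.
- by rewrite (Nil _ x0) (Nil _ y0).
Qed.

(** Merging depends only on types, and [m], [n], [k] share one: the first element of [x] merges with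
    all of them or with none. *)
Lemma impath_consA m n (k : felt E F) x : felt_merge m n = Some k ->
  impath_cons k x = impath_cons m (impath_cons n x).
Proof.
move=> H; case: x => [a|[|n' s] l|f] /=.
- by rewrite (felt_merge_some H).
- rewrite (elt_mergeA _ H); case nl: elt_merge => [l'|] /=; last by rewrite H.
  case ml': elt_merge => [//|]; case/elt_merge_none: ml'.
  have [_ ->] := elt_merge_type nl; have [-> _] := elt_merge_type (felt_merge_some H).
  by have [] := elt_merge_type nl.
- rewrite (felt_mergeA _ H); case nl: felt_merge => [l'|] /=; last by rewrite H.
  case ml': felt_merge => [//|]; case/elt_merge_none: (felt_merge_none ml').
  have [n1 n2] := elt_merge_type (felt_merge_some nl).
  by have [-> _] := elt_merge_type (felt_merge_some H); rewrite n1 n2.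
- rewrite (felt_mergeA _ H); case nl: felt_merge => [l'|] /=; last first.
    by rewrite H; congr II; apply/funext => -[].
  case ml': felt_merge => [a|].
    by congr II; apply/funext => -[].
  case/elt_merge_none: (felt_merge_none ml').
  have [n1 n2] := elt_merge_type (felt_merge_some nl).
  by have [-> _] := elt_merge_type (felt_merge_some H); rewrite n1 n2.
Qed.

End Paths.

(** * Cylinders under concatenation *)

Section Cylinders.
Context {E F : bool -> digraph}.
Variables (v : forall i, vert (E i)) (w : forall i, vert (F i)).
Hypotheses (hv : forall i, inf_emitter (E i) (v i))
  (hw : forall i, inf_emitter (F i) (w i)).
Implicit Types (m n : felt E F) (l k : elt E F) (s : seq (felt E F)).
Implicit Types (mu nu lam : fmpath E F) (x y z : impath E F).
Implicit Types (X Y : nat -> option (elt E F)).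

Local Notation fterm := (felt_term v w).
Local Notation eorig := (elt_orig v w).
Local Notation iorig := (impath_orig v w).
Local Notation morig := (@fmpath_orig E F v w).
Local Notation mterm := (fmpath_term v w).

(** The condition of [Zset] on a string, made recursive and stated for a bare sequence of elements,
    so that an induction can shift the sequence. *)
Fixpoint stream_ext s m X : Prop :=
  if s is n :: s' then X 0 = Some (elt_of n) /\ stream_ext s' m (fun j => X j.+1)
  else exists2 l, X 0 = Some l & elt_ext m l.

Definition impath_ext mu x : Prop :=
  match mu with
  | FV a => iorig x = a
  | FS s m => stream_ext s m (impath_elt x)
  end.

Lemma stream_extE s m X : stream_ext s m X <->
  (forall j, j < size s -> X j = Some (elt_of (nth m s j))) /\
  (exists2 l, X (size s) = Some l & elt_ext m l).
Proof.
elim: s X => [|n s IH] X /=; first by split=> [?|[]].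
rewrite IH; split=> [[X0 [XS H]]|[H H']]; split=> //.
  by case=> [//|j]; apply: XS.
  exact: (H 0).
by split=> // j; apply: (H j.+1).
Qed.

Lemma ZsetE mu (x : pathspace v w) : Zset mu x <-> impath_ext mu (sval x).
Proof. by case: mu => [a|s m] //=; rewrite stream_extE. Qed.

Lemma eq_stream_ext s m X Y : X =1 Y -> stream_ext s m X -> stream_ext s m Y.
Proof. by move=> /funext ->. Qed.

(** For [lam] a string, the type of the next element decides whether [m] merges, in [lam] and in [x]
    separately. If it merges in both or in neither, [m] cancels; if in just one of them, both sides
    are false. *)
Lemma impath_ext_merge m lam x : is_felt m -> is_fmpath v w lam ->
  morig lam = fterm m -> is_impath v w x -> iorig x = fterm m ->
  impath_ext (fmpath_cons m lam) (impath_cons m x) <-> impath_ext lam x.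
Proof.
move=> Wm Wlam lm Wx xm.
have xl l : impath_elt x 0 = Some l -> is_gelt l /\ fterm m = eorig l.
  by move=> x0; rewrite (impath_elt0_orig _ _ x0) xm; split=> //;
    exact: (is_gelt_impath_elt Wx x0).
have neq l : impath_elt x 0 = Some l -> elt_merge m l <> Some (elt_of m).
  by case/xl => Wl _; apply: elt_merge_neq.
case: lam Wlam lm => [a|[|n s] n'] /=.
- move=> _ am; rewrite am xm; split=> // _; rewrite impath_elt_cons.
  case x0: impath_elt => [l|]; last by exists (elt_of m) => //; apply: elt_ext_refl.
  case H: elt_merge => [k|]; last by exists (elt_of m) => //; apply: elt_ext_refl.
  by exists k => //; have [_ ml] := xl _ x0; exact: (elt_ext_merge Wm ml H).
- move=> [_ Wn] /esym mn; case Hk: felt_merge => [k|] /=; rewrite !impath_elt_cons.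
    have [mtn _] := elt_merge_type (felt_merge_some Hk).
    (* [k] is [m] lengthened by [n'], so [m] cannot extend it: dividing would write [m] as a proper
       extension of itself. *)
    have notk : ~ elt_ext k (elt_of m).
      have Wk := is_felt_merge Wm Wn mn Hk.
      case/(elt_ext_div v w Wk (proj1 (is_feltE _) Wm)).
        move/elt_of_inj => mk.
        have := @elt_merge_neq _ _ m _ (proj1 (is_feltE _) Wn).
        by rewrite (felt_merge_some Hk) mk.
      case=> l [Wl kl]; rewrite (elt_mergeA _ Hk).
      case Hl: elt_merge => [l'|] //=; apply: elt_merge_neq.
      by apply: (@is_gelt_merge _ _ v w _ _ _ Wn Wl _ Hl);
        rewrite -(felt_term_merge mn Hk).
    case x0: impath_elt => [l|]; last by split=> -[] // l [<-].
    case H: elt_merge => [k'|].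
      have [_ ml] := xl _ x0; have C := elt_ext_cancel Wm mn ml Hk H.
      by split=> -[_ [<-]] kl; [exists l|exists k'] => //; apply/C.
    split=> -[_ [<-]]; first by move/notk.
    by move/elt_ext_type => nl; move/elt_merge_none: H; rewrite mtn nl.
  have mtn := proj1 (elt_merge_none _ _) (felt_merge_none Hk).
  case x0: impath_elt => [l|]; last by split=> [[_ []]|[]].
  case H: elt_merge => [k|]; last by split=> [[]|].
  split=> [[[km]]|]; first by case: (neq _ x0); rewrite H km.
  case=> _ [<-] /elt_ext_type nl; case: mtn; rewrite nl.
  by have [] := elt_merge_type H.
- move=> [[Wn _ _] _] /esym mn; case Hk: felt_merge => [k|] /=;
    rewrite !impath_elt_cons.
    have [mtn _] := elt_merge_type (felt_merge_some Hk).
    have km : elt_of m <> elt_of k.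
      move/elt_of_inj => mk; have := @elt_merge_neq _ _ m _ (proj1 (is_feltE _) Wn).
      by rewrite (felt_merge_some Hk) -mk.
    case x0: impath_elt => [l|]; last by split=> -[] // [].
    case H: elt_merge => [k'|].
      have [_ ml] := xl _ x0.
      split=> -[[E0] H']; split.
      + congr Some; apply: (@elt_merge_inj _ _ v w m _ _ k'); first by rewrite -ml mn.
          exact: H.
        by rewrite (felt_merge_some Hk) E0.
      + by apply: (eq_stream_ext _ H') => j; rewrite impath_elt_cons x0 H.
      + by move: H; rewrite E0 (felt_merge_some Hk).
      + by apply: (eq_stream_ext _ H') => j; rewrite impath_elt_cons x0 H.
    split=> -[[E0]] //; move/elt_merge_none: H; by rewrite E0 mtn.
  have mtn := proj1 (elt_merge_none _ _) (felt_merge_none Hk).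
  case x0: impath_elt => [l|]; last by split=> [[_ []]|[]].
  case H: elt_merge => [k|].
    split=> [[[km]]|]; first by case: (neq _ x0); rewrite H km.
    by case=> -[nl]; case: mtn; rewrite -nl; have [] := elt_merge_type H.
  split=> [[_ [nl H']]|[nl H']]; first split=> //.
    by apply: (eq_stream_ext _ H') => j; rewrite impath_elt_cons x0 H.
  split=> //; split=> //; apply: (eq_stream_ext _ H') => j.
  by rewrite impath_elt_cons x0 H.
Qed.

(** The quotient drops the first element when that is exactly [m], and shortens it otherwise. If
    nothing is left after [m], the quotient is the vertex t(m), an infinite path by
    [elt_ends_term]. *)
Lemma impath_ext_div m x : is_felt m -> is_impath v w x ->
  impath_ext (FS [::] m) x ->
  exists z, [/\ is_impath v w z, iorig z = fterm m & x = impath_cons m z].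
Proof.
move=> Wm Wx /= [l x0 ml].
have [lm|[l' [Wl' ml' Hl]]] := elt_ext_div v w Wm (is_gelt_impath_elt Wx x0) ml.
  subst l; case: x Wx x0 => [//|[|n s] l|f] /=.
  - move=> [_ /is_ieltE[_ endm]] [lm]; exists (IV (fterm m)); split=> //;
      last by rewrite /= lm.
    by apply/(elt_ends_term hv hw); rewrite -lm.
  - case=> -[_ [nl nNl] Ws] Wl [/elt_of_inj nm]; subst n.
    exists (IS s l); split=> //.
    case: s nNl {nl Ws} => [|n s] /= /elt_merge_none; first by move=> ->.
    by rewrite elt_merge_of; case: felt_merge.
  - move=> Wf [/elt_of_inj fm]; exists (II (fun j => f j.+1)); split=> [j||].
    + exact: Wf.
    + by case: (Wf 0) => _ [] /= <- _; rewrite fm.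
    + case: (Wf 0) => _ [_ /elt_merge_none] /=; rewrite fm elt_merge_of.
      by case: felt_merge => // _; congr II; apply/funext => -[].
case: x Wx x0 => [//|[|n s] k|f] /=.
- move=> [_ /is_ieltE[Wl endl]] [kl]; subst k.
  exists (IS [::] l'); split=> //=; last by rewrite Hl.
  by split=> //; apply/is_ieltE; split=> //; rewrite -(elt_ends_merge ml' Hl).
- move=> [[Wn nk Ws] Wk] [nl]; subst l.
  have [n' ln' Hn] := elt_merge_fin Hl; subst l'; exists (IS (n' :: s) k).
  split=> //=; last by rewrite Hn.
  by split=> //; split=> //; [exact/is_feltE|apply/(linked_merge _ ml' Hn)].
- move=> Wf [fl]; subst l; have [n' ln' Hn] := elt_merge_fin Hl; subst l'.
  exists (II (fun j => if j is j'.+1 then f j else n')); split=> //=.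
    move=> [|j]; last exact: Wf.
    by split; [exact/is_feltE|apply/(linked_merge _ ml' Hn); case: (Wf 0)].
  by rewrite Hn; congr II; apply/funext => -[].
Qed.

Lemma impath_ext_consW m lam x : is_felt m -> is_fmpath v w lam ->
  morig lam = fterm m -> is_impath v w x ->
  impath_ext (fmpath_cons m lam) x -> impath_ext (FS [::] m) x.
Proof.
move=> Wm + + Wx; case: lam => [a|[|n s] l] //=.
- move=> [_ Wl] /esym ml; case H: felt_merge => [k|] /=; last first.
    by case=> x0 _; exists (elt_of m) => //; apply: elt_ext_refl.
  case=> k' x0 kk'; exists k' => //.
  have Wk := is_felt_merge Wm Wl ml H.
  have [->|[j [Wj kj]]] := elt_ext_div v w Wk (is_gelt_impath_elt Wx x0) kk'.
    exact: (elt_ext_merge Wm ml (felt_merge_some H)).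
  have lj : fterm l = eorig j by rewrite -kj (felt_term_merge ml H).
  rewrite (elt_mergeA _ H); case Hj: elt_merge => [j'|] //=.
  by apply: (@elt_ext_merge _ _ v w _ _ _ Wm); rewrite (elt_orig_merge Wl lj Hj).
- move=> [[Wn _ _] Wl] /esym mn; case H: felt_merge => [k|] /= [x0 _].
    by exists (elt_of k) => //; apply: (elt_ext_merge Wm mn (felt_merge_some H)).
  by exists (elt_of m) => //; apply: elt_ext_refl.
Qed.

Lemma impath_ext_orig mu x : impath_ext mu x -> iorig x = morig mu.
Proof.
case: mu => [a|[|n s] m] //=.
  by case=> l /(impath_elt0_orig v w) <- /(elt_ext_orig v w) <-.
by case=> /(impath_elt0_orig v w) <-.
Qed.

Lemma is_fmpath_cons m mu : is_felt m -> is_fmpath v w mu -> morig mu = fterm m ->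
  [/\ is_fmpath v w (fmpath_cons m mu),
      morig (fmpath_cons m mu) = eorig (elt_of m)
    & mterm (fmpath_cons m mu) = mterm mu].
Proof.
move=> Wm; case: mu => [a|[|n s] l].
- by move=> _ /= ->.
- move=> [_ Wl] /= /esym ml; case H: felt_merge => [k|] /=.
    rewrite (elt_orig_merge Wm ml (felt_merge_some H)) (felt_term_merge ml H).
    by split=> //; split=> //; exact: (is_felt_merge Wm Wl ml H).
  split=> //; split=> //; split=> //; split=> //.
  exact/elt_merge_none/felt_merge_none.
- move=> [[Wn nl Ws] Wl] /= /esym mn; case H: felt_merge => [k|] /=.
    rewrite (elt_orig_merge Wm mn (felt_merge_some H)); split=> //; split=> //.
    by split=> //; [exact: (is_felt_merge Wm Wn mn H)|apply/(linked_merge _ mn H)].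
  split=> //; split=> //; split=> //; split=> //.
  exact/elt_merge_none/felt_merge_none.
Qed.

Lemma felt_merge_type m n (k : felt E F) : felt_merge m n = Some k ->
  elt_type (elt_of m) = elt_type (elt_of n) /\ elt_type (elt_of k) = elt_type
    (elt_of n).
Proof. by move/felt_merge_some/elt_merge_type. Qed.

Lemma felt_merge_neq_none m n : elt_type (elt_of m) = elt_type (elt_of n) ->
  felt_merge m n <> None.
Proof. by move=> H /felt_merge_none/elt_merge_none. Qed.

Lemma fmpath_consA m n (k : felt E F) lam : felt_merge m n = Some k ->
  fmpath_cons k lam = fmpath_cons m (fmpath_cons n lam).
Proof.
move=> H; case: lam => [a|[|n' s] l] /=; first by rewrite H.
- rewrite (felt_mergeA _ H); case nl: felt_merge => [l'|] /=; last by rewrite H.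
  case ml': felt_merge => [//|]; case: (felt_merge_neq_none _ ml').
  by case: (felt_merge_type nl) (felt_merge_type H) => n1 n2 [n3 _]; rewrite n3 n1 n2.
- rewrite (felt_mergeA _ H); case nl: felt_merge => [l'|] /=; last by rewrite H.
  case ml': felt_merge => [//|]; case: (felt_merge_neq_none _ ml').
  by case: (felt_merge_type nl) (felt_merge_type H) => n1 n2 [n3 _]; rewrite n3 n1 n2.
Qed.

Lemma fmpath_cons_string n s m : is_fmpath v w (FS (n :: s) m) ->
  [/\ is_felt n, is_fmpath v w (FS s m), morig (FS s m) = fterm n &
      FS (n :: s) m = fmpath_cons n (FS s m)].
Proof.
case=> -[Wn [ns nNs] Ws] Wm; split=> //.
  by rewrite ns; case: (s).
case: s nNs {ns Ws} => [|n' s] /= /elt_merge_none; rewrite elt_merge_of;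
  by case: felt_merge.
Qed.

(** Induction along [fmpath_cons], from the terminus backwards: a law for [fmpath_cat] follows from
    its case of a single element, where merging has been dealt with. *)
Lemma fmpath_ind_cons (P : fmpath E F -> Prop) :
  (forall a, P (FV a)) ->
  (forall m mu, is_felt m -> is_fmpath v w mu -> morig mu = fterm m ->
     P mu -> P (fmpath_cons m mu)) ->
  forall mu, is_fmpath v w mu -> P mu.
Proof.
move=> PV Pcons [a|s m]; first by move=> _.
elim: s => [|n s IH] H.
  by apply: (Pcons m (FV (fterm m))) => //; case: H.
by have [Wn Ws sn ->] := fmpath_cons_string H; apply: Pcons => //; apply: IH.
Qed.

Lemma impath_cat_cons m mu x :
  impath_cat (fmpath_cons m mu) x = impath_cons m (impath_cat mu x).
Proof.
by case: mu => [a|[|n s] l] //=; case H: felt_merge => [k|] //=;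
  rewrite (impath_consA _ H).
Qed.

Lemma fmpath_cat_cons m mu lam :
  fmpath_cat (fmpath_cons m mu) lam = fmpath_cons m (fmpath_cat mu lam).
Proof.
rewrite /fmpath_cat; case: mu => [a|[|n s] l] //=; case H: felt_merge => [k|] //=;
by rewrite (fmpath_consA _ H).
Qed.

Lemma is_impath_cat mu x : is_fmpath v w mu -> is_impath v w x ->
  iorig x = mterm mu ->
  is_impath v w (impath_cat mu x) /\ iorig (impath_cat mu x) = morig mu.
Proof.
move=> Wmu Wx; elim/fmpath_ind_cons: Wmu => [a //|m nu Wm Wnu mn IH].
have [_ -> ->] := is_fmpath_cons Wm Wnu mn.
move=> /IH[Wn E0]; rewrite impath_cat_cons.
by apply: is_impath_cons => //; rewrite E0.
Qed.

Lemma is_fmpath_cat mu lam : is_fmpath v w mu -> is_fmpath v w lam ->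
  morig lam = mterm mu ->
  [/\ is_fmpath v w (fmpath_cat mu lam), morig (fmpath_cat mu lam) = morig mu
    & mterm (fmpath_cat mu lam) = mterm lam].
Proof.
move=> Wmu Wlam; elim/fmpath_ind_cons: Wmu => [a //|m nu Wm Wnu mn IH].
have [_ -> ->] := is_fmpath_cons Wm Wnu mn.
move=> /IH[Wn E0 <-]; rewrite fmpath_cat_cons.
by apply: is_fmpath_cons => //; rewrite E0.
Qed.

Lemma impath_catA mu lam x : is_fmpath v w mu ->
  impath_cat (fmpath_cat mu lam) x = impath_cat mu (impath_cat lam x).
Proof.
elim/fmpath_ind_cons => [a //|m nu Wm Wnu mn IH].
by rewrite fmpath_cat_cons !impath_cat_cons IH.
Qed.

Lemma impath_cat_inj mu x y : is_fmpath v w mu -> is_impath v w x ->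
  is_impath v w y -> iorig x = mterm mu -> iorig y = mterm mu ->
  impath_cat mu x = impath_cat mu y -> x = y.
Proof.
move=> Wmu Wx Wy; elim/fmpath_ind_cons: Wmu => [a //|m nu Wm Wnu mn IH].
have [_ _ ->] := is_fmpath_cons Wm Wnu mn => xn yn.
have [W1 E1] := is_impath_cat Wnu Wx xn; have [W2 E2] := is_impath_cat Wnu Wy yn.
rewrite !impath_cat_cons => /(impath_cons_inj W1 W2); rewrite E1 E2 => /(_ mn mn).
exact: IH.
Qed.

(** One element at a time: [impath_ext_consW] and [impath_ext_div] split off the first element, and
    [impath_ext_merge] cancels it. The outcome is Z(mu lam) = mu Z(lam). *)
Lemma impath_ext_catP mu lam x : is_fmpath v w mu -> is_fmpath v w lam ->
  morig lam = mterm mu -> is_impath v w x ->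
  impath_ext (fmpath_cat mu lam) x <->
  exists z, [/\ is_impath v w z, iorig z = mterm mu, impath_ext lam z
              & x = impath_cat mu z].
Proof.
move=> Wmu Wlam; elim/fmpath_ind_cons: Wmu x => [a|m nu Wm Wnu mn IH] x.
  move=> lama Wx; split=> [H|[z [_ _ H ->]]//].
  by exists x; split=> //; rewrite (impath_ext_orig H).
have [_ _ ->] := is_fmpath_cons Wm Wnu mn => lamn Wx.
have [Wnl E0 _] := is_fmpath_cat Wnu Wlam lamn.
rewrite fmpath_cat_cons; split.
  move=> H; have nlm : morig (fmpath_cat nu lam) = fterm m by rewrite E0.
  have [y [Wy ym Ex]] := impath_ext_div Wm Wx (impath_ext_consW Wm Wnl nlm Wx H).
  move: H; rewrite Ex impath_ext_merge// IH// => -[z [Wz zn lamz Ey]].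
  by exists z; split=> //; rewrite impath_cat_cons -Ey.
case=> z [Wz zn lamz ->]; rewrite impath_cat_cons.
have [W1 E1] := is_impath_cat Wnu Wz zn.
apply/impath_ext_merge => //; rewrite ?E0 ?E1//.
by apply/IH => //; exists z.
Qed.

Lemma fmpath_rcons_cons m mu n :
  fmpath_rcons (fmpath_cons m mu) n = fmpath_cons m (fmpath_rcons mu n).
Proof.
case: mu => [a|[|n' s] l] //=.
- case H: felt_merge => [k|] /=.
    rewrite (felt_mergeA _ H); case nl: felt_merge => [l'|] /=; last by rewrite H.
    case ml': felt_merge => [//|]; case: (felt_merge_neq_none _ ml').
    by case: (felt_merge_type nl) (felt_merge_type H) => n1 n2 [n3 _]; rewrite n3 n1 n2.
  case nl: felt_merge => [l'|] /=; last by rewrite H.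
  case ml': felt_merge => [l2|//]; case: (@felt_merge_neq_none m l) => //.
  by case: (felt_merge_type nl) (felt_merge_type ml') => n1 n2 [n3 _]; rewrite n3 n1 n2.
- by case H: felt_merge => [k|] /=; case: felt_merge => [j|] /=; rewrite H.
Qed.

Lemma fmpath_rcons_cat mu lam n : is_fmpath v w mu ->
  fmpath_rcons (fmpath_cat mu lam) n = fmpath_cat mu (fmpath_rcons lam n).
Proof.
elim/fmpath_ind_cons => [a //|m nu Wm Wnu mn IH].
by rewrite !fmpath_cat_cons fmpath_rcons_cons IH.
Qed.

Lemma felt_len_merge m n (k : felt E F) : felt_merge m n = Some k ->
  (felt_len k).1 = (felt_len m).1 + (felt_len n).1 /\
  (felt_len k).2 = (felt_len m).2 + (felt_len n).2.
Proof.
by case: m n => [p|[] p q] [p'|[] p' q'] //= [] <- /=;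
  rewrite /finpath_len /= !size_cat.
Qed.

Lemma fmpath_len_cons m mu :
  (fmpath_len (fmpath_cons m mu)).1 = (felt_len m).1 + (fmpath_len mu).1 /\
  (fmpath_len (fmpath_cons m mu)).2 = (felt_len m).2 + (fmpath_len mu).2.
Proof.
case: mu => [a|[|n s] l] /=; first by rewrite !big_seq1 !addn0.
- case H: felt_merge => [k|] /=; last by rewrite !big_cons !big_nil !addn0.
  by rewrite !big_cons !big_nil !addn0; apply: felt_len_merge.
- case H: felt_merge => [k|] /=; last by rewrite !big_cons.
  by rewrite !big_cons; case: (felt_len_merge H) => -> ->; rewrite !addnA.
Qed.

Lemma fmpath_len_cat mu lam : is_fmpath v w mu ->
  (fmpath_len (fmpath_cat mu lam)).1 = (fmpath_len mu).1 + (fmpath_len lam).1 /\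
  (fmpath_len (fmpath_cat mu lam)).2 = (fmpath_len mu).2 + (fmpath_len lam).2.
Proof.
elim/fmpath_ind_cons => [a //|m nu Wm Wnu mn [IH1 IH2]].
rewrite fmpath_cat_cons; have [-> ->] := fmpath_len_cons m (fmpath_cat nu lam).
by rewrite IH1 IH2; have [-> ->] := fmpath_len_cons m nu; rewrite !addnA.
Qed.

End Cylinders.

(** * Unique initial pieces, and preimages of cylinders under prepending *)

Section Residuals.
Context {E F : bool -> digraph}.
Variables (v : forall i, vert (E i)) (w : forall i, vert (F i)).
Hypotheses (hv : forall i, inf_emitter (E i) (v i))
  (hw : forall i, inf_emitter (F i) (w i)).
Implicit Types (m n : felt E F) (l k : elt E F) (s : seq (felt E F)).
Implicit Types (mu nu lam : fmpath E F) (x y z : impath E F).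
Implicit Types (X Y : nat -> option (elt E F)).

Local Notation fterm := (felt_term v w).
Local Notation eorig := (elt_orig v w).
Local Notation iorig := (impath_orig v w).
Local Notation morig := (@fmpath_orig E F v w).

Local Arguments gpath_ext : simpl never.
Local Arguments gpath_cat : simpl never.

Lemma felt_len_gt0 m : is_felt m -> 0 < (felt_len m).1 + (felt_len m).2.
Proof.
case: m => [p|i p q] /=; first by case=> _; rewrite addn_gt0 => ->.
by case=> _ _; rewrite addn_gt0 => -[] ->; rewrite ?orbT.
Qed.

Lemma fmpath_len_gt0 s m : is_felt m ->
  0 < (fmpath_len (FS s m)).1 + (fmpath_len (FS s m)).2.
Proof.
move/felt_len_gt0 => m0; rewrite /= -cats1 !big_cat !big_seq1 /=.
by rewrite addnACA addn_gt0 m0 orbT.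
Qed.

Lemma elt_ext_uniq m n l : elt_ext m l -> elt_ext n l ->
  felt_len m = felt_len n -> m = n.
Proof.
move=> ml nl; have tn := elt_ext_type nl; destruct (same_typeP (elt_ext_type ml))
  as [p g|i p q g h].
  case: n nl tn => [p' pg' _ [lp]|//].
  by rewrite (gpath_ext_uniq ml pg' lp).
case: n nl tn => [//|j p' q'] nl tn; have ij : j = i by case: tn.
subst j; move: ml nl; rewrite !elt_extP => -[pg qh] [pg' qh'] [lp lq].
by rewrite (gpath_ext_uniq pg pg' lp) (gpath_ext_uniq qh qh' lq).
Qed.

Lemma elt_ext_len m n : elt_ext m (elt_of n) ->
  (felt_len m).1 <= (felt_len n).1 /\ (felt_len m).2 <= (felt_len n).2.
Proof.
have le (G : digraph) (p q : finpath G) : gpath_ext p (Fin q) -> size p.2 <= size q.2.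
  by case=> _ [es ->]; rewrite size_cat leq_addr.
move=> mn; have := elt_ext_type mn; case: m n mn => [p|i p q] [p'|j p' q'] //.
  by move=> /le.
move=> + tn; have ij : i = j by case: tn.
by subst j; rewrite elt_extP => -[/le ? /le].
Qed.

(** The first test makes [m] an initial piece of the complete element [n], hence no longer than [n]
    in either coordinate; the other path is longer than [n] by at least the element [k], of positive
    length. *)
Lemma stream_ext_len_lt m n s (k : felt E F) X : is_felt k ->
  stream_ext [::] m X -> stream_ext (n :: s) k X ->
  fmpath_len (FS [::] m) = fmpath_len (FS (n :: s) k) -> False.
Proof.
move=> Wk /= [l -> ml] [[ln] _]; subst l; have [le1 le2] := elt_ext_len ml.
have := fmpath_len_gt0 s Wk; rewrite /= !big_cons !big_nil !addn0 => gt0 [E1 E2].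
move: gt0 le1 le2; rewrite E1 E2 addn_gt0 => /orP[] gt0 le1 le2.
  by move: le1; rewrite -{2}(addn0 (felt_len n).1) leq_add2l leqNgt gt0.
by move: le2; rewrite -{2}(addn0 (felt_len n).2) leq_add2l leqNgt gt0.
Qed.

(** Length in N^2, rather than total length, determines an initial piece, since a product element
    can be cut independently in its two coordinates. This later identifies mu_2 with nu mu_1 from a
    common extension and equal degrees. *)
Lemma impath_ext_uniq mu nu x : is_fmpath v w mu -> is_fmpath v w nu ->
  impath_ext v w mu x -> impath_ext v w nu x -> fmpath_len mu = fmpath_len nu ->
  mu = nu.
Proof.
have FVFS (a : Overt E F) s m : is_fmpath v w (FS s m) ->
  fmpath_len (FV a) = fmpath_len (FS s m) -> False.
  by case=> _ /(fmpath_len_gt0 s) + [E1 E2]; rewrite /= -E1 -E2.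
case: mu nu => [a|s m] [b|s' m'].
- by move=> _ _ /= -> ->.
- by move=> _ W _ _ /(FVFS _ _ _ W).
- by move=> W _ _ _ /esym/(FVFS _ _ _ W).
rewrite /impath_ext; move: (impath_elt x) => X.
elim: s s' X => [|n s IH] [|n' s'] X Ws Ws'.
- move=> /= [l -> ml] [_ [<-] m'l]; rewrite !big_seq1 => -[E1 E2]; congr FS.
  apply: elt_ext_uniq ml m'l _.
  by case: (felt_len m) (felt_len m') E1 E2 => [? ?] [? ?] /= -> ->.
- by move=> H H' L; case: (stream_ext_len_lt _ H H' L); case: Ws'.
- by move=> H H' L; case: (stream_ext_len_lt _ H' H (esym L)); case: Ws.
- have [_ Wss _ _] := fmpath_cons_string Ws.
  have [_ Wss' _ _] := fmpath_cons_string Ws'.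
  move=> [X0 H] [X0' H']; have En : n = n'.
    by apply: elt_of_inj; move: X0; rewrite X0' => -[].
  subst n'; rewrite /= !big_cons => -[/addnI E1 /addnI E2].
  by have [-> ->] : FS s m = FS s' m' by apply: (IH _ _ Wss Wss' H H'); congr pair.
Qed.

Lemma impath_cons_elt0 m z : exists2 l', impath_elt (impath_cons m z) 0 = Some l' &
  (exists2 l, impath_elt z 0 = Some l & elt_merge m l = Some l') \/
  (l' = elt_of m /\ forall l, impath_elt z 0 = Some l ->
    elt_type (elt_of m) <> elt_type l).
Proof.
rewrite impath_elt_cons; case z0: impath_elt => [l|]; last first.
  by exists (elt_of m) => //; right.
case H: elt_merge => [k|]; first by exists k => //; left; exists l.
by exists (elt_of m) => //; right; split=> // _ [<-]; apply/elt_merge_none.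
Qed.

Lemma finpath_nullE (G : digraph) (r : finpath G) : r.2 = [::] -> r = null_at r.1.
Proof. by case: r => a es /= ->. Qed.

Lemma gpath_ext_null_null (G : digraph) (r : finpath G) a :
  gpath_ext r (Fin (null_at a)) -> r = null_at a.
Proof. by case: r => b [|e es] [/= -> [es']]. Qed.

(** [gpath_ext_residual] in each coordinate. The residual is a vertex only if it is null throughout;
    a product residual that is null in one coordinate is still a path element. *)
Lemma impath_ext_residual1 m n : is_felt m -> is_felt n ->
  elt_type (elt_of m) = elt_type (elt_of n) ->
  (forall z, is_impath v w z -> iorig z = fterm m ->
     ~ impath_ext v w (FS [::] n) (impath_cons m z)) \/
  exists lam, [/\ is_fmpath v w lam, morig lam = fterm m & forall z,
    is_impath v w z -> iorig z = fterm m ->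
    impath_ext v w (FS [::] n) (impath_cons m z) <-> impath_ext v w lam z].
Proof.
move=> Wm Wn mn.
case: m n mn Wm Wn => [p|i p q] [l|j l l'] // mn.
  move=> [Wp p0] [Wl l0].
  have [H|[r [Wr rp H]]] := gpath_ext_residual Wl Wp.
    left=> z Wz zp /= [k]; have [k' -> Hk] := impath_cons_elt0 (FD p) z => -[<-].
    case: Hk => [[l1 z0]|[-> _]] /=; last by rewrite -(gpath_cat_null p); exact: H.
    case: l1 z0 => // g z0 [<-] /=; apply: H.
    apply: (@link_D _ _ v w); apply: (etrans (esym zp)); exact/esym/impath_elt0_orig.
  right; have [r0|r0] := pselect (r.2 = [::]).
    have Er : r = null_at (finpath_term p) by rewrite -rp; exact: finpath_nullE.
    exists (FV (fterm (FD p))); split=> // z Wz zp /=; split=> // _.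
    have [k' -> Hk] := impath_cons_elt0 (FD p) z; exists k' => //.
    case: Hk => [[l1 z0]|[-> _]] /=; last first.
      by rewrite -(gpath_cat_null p); apply/H => //; rewrite Er; apply/gpath_ext_null.
    case: l1 z0 => // g z0 [<-] /=; have gp : gpath_orig g = finpath_term p.
      by apply: (@link_D _ _ v w); apply: (etrans (esym zp));
        exact/esym/impath_elt0_orig.
    by apply/H => //; rewrite Er; apply/gpath_ext_null.
  exists (FS [::] (FD r)); split=> /=; first by split=> //; split=> //;
    rewrite /finpath_len; case: (r.2) r0.
    by rewrite rp.
  move=> z Wz zp; have [k' -> Hk] := impath_cons_elt0 (FD p) z.
  case: Hk => [[l1 z0]|[-> Hz]] /=; last first.
    split=> [[_ [<-]]|[l1 /Hz]]; last by case: l1.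
    rewrite -(gpath_cat_null p) => /(H (Fin (null_at _)) erefl)/gpath_ext_null_null Er.
    by case: r0; rewrite Er.
  rewrite z0; case: l1 z0 => // g z0 [<-] /=; have gp : gpath_orig g = finpath_term p.
    by apply: (@link_D _ _ v w); apply: (etrans (esym zp)); exact/esym/impath_elt0_orig.
  by split=> -[_ [<-]] /(H _ gp) rg; eexists; eauto.
have ij : i = j by case: mn.
subst j => -[Wp Wq pq0] [Wl Wl' ll0].
have orig g h z : iorig z = fterm (FP p q) -> impath_elt z 0 = Some (GP g h) ->
    gpath_orig g = finpath_term p /\ gpath_orig h = finpath_term q.
  by move=> zp z0; apply: (@link_P _ _ v w); apply: (etrans (esym zp));
    exact/esym/impath_elt0_orig.
(* If [z] is a vertex or starts with another type, [FP p q] stays a separate element; null paths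
   [g], [h] bring this case under the same formula as the merged one. *)
have ext0 z : iorig z = fterm (FP p q) -> exists g h,
   [/\ gpath_orig g = finpath_term p, gpath_orig h = finpath_term q,
     impath_elt (impath_cons (FP p q) z) 0 = Some (GP (gpath_cat p g) (gpath_cat q h)) &
     impath_elt z 0 = Some (GP g h) \/ ([/\ g = Fin (null_at (finpath_term p)),
       h = Fin (null_at (finpath_term q)) &
       forall k, impath_elt z 0 = Some k -> elt_type k <> Some i])].
  move=> zp; have [k' -> [[k1 z0]|[-> Hz]]] := impath_cons_elt0 (FP p q) z.
    move=> H; have [tk _] := elt_merge_type H; case: k1 z0 H tk => [//|j g h] z0 + tk.
    have ij : i = j by case: tk.
    subst j; have [gp hq] := orig _ _ _ zp z0; rewrite elt_mergeP => -[<-].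
    by exists g, h; split=> //; left.
  exists (Fin (null_at (finpath_term p))), (Fin (null_at (finpath_term q))).
  rewrite !gpath_cat_null; split=> //; right; split=> // k /Hz H H'.
  by apply: H; rewrite H'.
have extP z : iorig z = fterm (FP p q) ->
    impath_ext v w (FS [::] (FP l l')) (impath_cons (FP p q) z) <->
    exists g h, [/\ gpath_ext l (gpath_cat p g), gpath_ext l' (gpath_cat q h),
      gpath_orig g = finpath_term p, gpath_orig h = finpath_term q
      & impath_elt z 0 = Some (GP g h) \/ ([/\ g = Fin (null_at (finpath_term p)),
       h = Fin (null_at (finpath_term q)) &
       forall k, impath_elt z 0 = Some k -> elt_type k <> Some i])].
  move=> zp; have [g [h [gp hq E0 Hz]]] := ext0 _ zp;
    rewrite /impath_ext /stream_ext E0; split.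
    by case=> _ [<-]; rewrite elt_extP => -[? ?]; exists g, h.
  case=> g' [h' [lg lh gp' hq' Hz']]; eexists; first by [].
  suff [-> ->] : g = g' /\ h = h' by rewrite elt_extP.
  case: Hz Hz' => [z0|[-> -> Hz]] [z0'|[-> -> Hz']] //.
  - by apply: GP_inj; apply: Some_inj; rewrite -z0 -z0'.
  - by case: (Hz' _ z0).
  - by case: (Hz _ z0').
have [H|[r [Wr rp H]]] := gpath_ext_residual Wl Wp.
  by left=> z Wz zp /(extP _ zp)[g [h [lg _ gp _ _]]]; case: (H g gp).
have [H'|[r' [Wr' rq H']]] := gpath_ext_residual Wl' Wq.
  by left=> z Wz zp /(extP _ zp)[g [h [_ lh _ hq _]]]; case: (H' h hq).
right; have [[r0 r0']|r0] := pselect (r.2 = [::] /\ r'.2 = [::]).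
  have Er : r = null_at (finpath_term p) by rewrite -rp; exact: finpath_nullE.
  have Er' : r' = null_at (finpath_term q) by rewrite -rq; exact: finpath_nullE.
  exists (FV (fterm (FP p q))); split=> // z Wz zp; split=> // _; apply/extP => //.
  have [g [h [gp hq _ Hz]]] := ext0 _ zp; exists g, h; split=> //.
    by apply/H => //; rewrite Er; apply/gpath_ext_null.
  by apply/H' => //; rewrite Er'; apply/gpath_ext_null.
exists (FS [::] (FP r r')); split.
- split=> //; split=> //; rewrite /finpath_len.
  case: (r.2) r0 => [|? ?] r0; last by left.
  by case: (r'.2) r0 => [[] //|? ?] _; right.
- by rewrite /= rp rq.
move=> z Wz zp; rewrite extP// /impath_ext /stream_ext; split.
  case=> g [h [/(H _)lg /(H' _)lh gp hq Hz]].
  have {}lg := lg gp; have {}lh := lh hq.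
  case: Hz => [->|[Eg Eh _]]; first by exists (GP g h); rewrite ?elt_extP.
  move: lg lh; rewrite Eg Eh => /gpath_ext_null_null Er /gpath_ext_null_null Er'.
  by case: r0; rewrite Er Er'.
case=> k z0 rk; have := elt_ext_type rk; case: k z0 rk => [//|j g h] z0 + tk.
have ij : i = j by case: tk.
subst j; have [gp hq] := orig _ _ _ zp z0; rewrite elt_extP => -[rg rh].
by exists g, h; split=> //; [apply/H|apply/H'|left].
Qed.

(** What continuity of z |-> m z needs: cylinders pull back to cylinders or to the empty set. When
    [lam] has several elements, the first is complete, so it must extend [m]; the residual divides
    it by [m], or drops it if it equals [m]. *)
Lemma impath_ext_residual m lam : is_felt m -> is_fmpath v w lam ->
  (forall z, is_impath v w z -> iorig z = fterm m ->
     ~ impath_ext v w lam (impath_cons m z)) \/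
  exists lam', [/\ is_fmpath v w lam', morig lam' = fterm m & forall z,
    is_impath v w z -> iorig z = fterm m ->
    impath_ext v w lam (impath_cons m z) <-> impath_ext v w lam' z].
Proof.
move=> Wm.
have extm z : is_impath v w z -> iorig z = fterm m ->
    impath_ext v w (FS [::] m) (impath_cons m z).
  move=> Wz zm.
  exact: (proj2 (@impath_ext_merge _ _ v w m (FV (fterm m)) z Wm I erefl Wz zm) zm).
case: lam => [a|[|n s] n'].
- move=> _; have [ma|ma] := pselect (eorig (elt_of m) = a).
    right; exists (FV (fterm m)); split=> // z Wz zm; split=> //= _.
    by have [_ ->] := is_impath_cons hv hw Wm Wz zm.
  by left=> z Wz zm /=; have [_ ->] := is_impath_cons hv hw Wm Wz zm.
- move=> [_ Wn]; have [mn|mn] := pselect (elt_type (elt_of m) = elt_type (elt_of n')).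
    exact: impath_ext_residual1.
  left=> z Wz zm [l z0 /elt_ext_type nl]; have [l' + /elt_ext_type ml] := extm _ Wz zm.
  by rewrite z0 => -[ll']; case: mn; rewrite ml -ll' nl.
move=> Wlam; have [Wn Ws sn Elam] := fmpath_cons_string Wlam.
have [mn|mn] := pselect (elt_ext m (elt_of n)); last first.
  left=> z Wz zm [z0 _]; have [l'] := extm _ Wz zm.
  by rewrite z0 => -[<-].
right; have [nm|[l [Wl ml Hl]]] := elt_ext_div v w Wm (proj1 (is_feltE _) Wn) mn.
  move/elt_of_inj: nm => nm; subst n; exists (FS s n'); split=> // z Wz zm.
  by rewrite Elam impath_ext_merge.
have [r lr Hr] := elt_merge_fin Hl; subst l.
case: Wlam => -[_ nh _] Wn'.
have Wr : is_fmpath v w (FS (r :: s) n').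
  case: (Ws) => Lk _; split=> //; split=> //; first exact/is_feltE.
  exact/(linked_merge _ ml Hr).
exists (FS (r :: s) n'); split=> // z Wz zm.
have -> : FS (n :: s) n' = fmpath_cons m (FS (r :: s) n') by rewrite /= Hr.
exact: impath_ext_merge.
Qed.

End Residuals.

(** * Translation by a finite path is injective and open *)

Section Topology.
Context {E F : bool -> digraph}.
Variables (v : forall i, vert (E i)) (w : forall i, vert (F i)).
Hypotheses (hv : forall i, inf_emitter (E i) (v i))
  (hw : forall i, inf_emitter (F i) (w i)).
Implicit Types (m n : felt E F) (l k : elt E F) (s : seq (felt E F)).
Implicit Types (mu nu lam : fmpath E F) (x y z : pathspace v w).
Implicit Types (U V : set (pathspace v w)).

Local Notation fterm := (felt_term v w).
Local Notation eorig := (elt_orig v w).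
Local Notation iorig := (impath_orig v w).
Local Notation morig := (@fmpath_orig E F v w).
Local Notation mterm := (fmpath_term v w).
Local Notation Z := (@Zset E F v w).

(** Concatenation as a total map of the unit space, with the junk value [z] where mu z is undefined.
    Composability is expressed as [Z (FV (mterm mu)) z], which is moreover an open condition on
    [z]. *)
Definition pcat mu z : pathspace v w :=
  if pselect (is_impath v w (impath_cat mu (sval z))) is left H
  then exist _ _ H else z.

Lemma sval_pcat mu z : is_fmpath v w mu -> Z (FV (mterm mu)) z ->
  sval (pcat mu z) = impath_cat mu (sval z).
Proof.
move=> Wmu zmu; rewrite /pcat; case: pselect => //= H; case: H.
by have [] := is_impath_cat hv hw Wmu (svalP z) zmu.
Qed.

Lemma pathspace_eq x y : sval x = sval y -> x = y.
Proof.
by case: x y => [x Wx] [y Wy] /= xy; subst y; congr exist; apply: Prop_irrelevance.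
Qed.

Lemma Zset_orig mu x : Z mu x -> iorig (sval x) = morig mu.
Proof. by move/ZsetE/impath_ext_orig. Qed.

Lemma pcat_inj mu y z : is_fmpath v w mu -> Z (FV (mterm mu)) y ->
  Z (FV (mterm mu)) z -> pcat mu y = pcat mu z -> y = z.
Proof.
move=> Wmu ymu zmu /(congr1 sval); rewrite !sval_pcat// => H.
apply: pathspace_eq.
exact: (impath_cat_inj hv hw Wmu (svalP y) (svalP z) ymu zmu H).
Qed.

Lemma Zset_catP mu lam x : is_fmpath v w mu -> is_fmpath v w lam ->
  morig lam = mterm mu ->
  Z (fmpath_cat mu lam) x <-> exists2 z, Z lam z & x = pcat mu z.
Proof.
move=> Wmu Wlam lammu; rewrite ZsetE.
rewrite (impath_ext_catP hv hw Wmu Wlam lammu (svalP x)); split.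
  move=> [z [Wz zmu lamz Ex]]; exists (exist _ z Wz); first exact/ZsetE.
  by apply: pathspace_eq; rewrite sval_pcat.
case=> z lamz ->; exists (sval z); split=> //.
- exact: svalP.
- by rewrite (Zset_orig lamz).
- exact/ZsetE.
- by rewrite sval_pcat//= (Zset_orig lamz).
Qed.

Lemma Zset_cat mu lam z : is_fmpath v w mu -> is_fmpath v w lam ->
  morig lam = mterm mu -> Z (FV (mterm mu)) z ->
  Z (fmpath_cat mu lam) (pcat mu z) <-> Z lam z.
Proof.
move=> Wmu Wlam lammu zmu; rewrite Zset_catP//; split; last by exists z.
case=> z' lamz' /pcat_inj -> //.
by rewrite /= (Zset_orig lamz').
Qed.

Lemma pcat_cat mu lam z : is_fmpath v w mu -> is_fmpath v w lam ->
  morig lam = mterm mu -> Z (FV (mterm lam)) z ->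
  pcat (fmpath_cat mu lam) z = pcat mu (pcat lam z).
Proof.
move=> Wmu Wlam lammu zlam.
have [Wml _ Eml] := is_fmpath_cat Wmu Wlam lammu.
have [_ lamz] := is_impath_cat hv hw Wlam (svalP z) zlam.
apply: pathspace_eq; rewrite sval_pcat ?Eml// sval_pcat//.
  by rewrite sval_pcat// (impath_catA _ _ Wmu).
by rewrite /= sval_pcat// lamz.
Qed.

Lemma fmpath_cat_FV mu : is_fmpath v w mu -> fmpath_cat mu (FV (mterm mu)) = mu.
Proof.
elim/(@fmpath_ind_cons E F v w) => [//|m nu Wm Wnu mn IH].
by rewrite fmpath_cat_cons; have [_ _ ->] := is_fmpath_cons Wm Wnu mn; rewrite IH.
Qed.

Lemma ZsetP mu x : is_fmpath v w mu ->
  Z mu x <-> exists2 z, Z (FV (mterm mu)) z & x = pcat mu z.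
Proof. by move=> Wmu; rewrite -Zset_catP// fmpath_cat_FV. Qed.

Lemma is_fmpath_rcons mu n : is_fmpath v w mu -> is_felt n ->
  eorig (elt_of n) = mterm mu ->
  [/\ is_fmpath v w (fmpath_rcons mu n), morig (fmpath_rcons mu n) = morig mu
    & mterm (fmpath_rcons mu n) = fterm n].
Proof.
move=> Wmu Wn nmu.
have -> : fmpath_rcons mu n = fmpath_cat mu (FS [::] n).
  by rewrite -{1}(fmpath_cat_FV Wmu) (fmpath_rcons_cat _ _ Wmu).
exact: (is_fmpath_cat Wmu).
Qed.

Lemma D_felt_rcons mu i e : is_fmpath v w mu -> mterm mu = Ou v w i ->
  D_orig e = Du i -> is_fmpath v w (fmpath_rcons mu (D_felt e)).
Proof.
move=> Wmu mui ei; have [] // := @is_fmpath_rcons mu (D_felt e) Wmu.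
by rewrite /= ei mui.
Qed.

Lemma E_felt_rcons mu i (y : vert (E i)) (z : vert (F i)) e :
  is_fmpath v w mu -> mterm mu = Oprod y z -> orig e = y ->
  is_fmpath v w (fmpath_rcons mu (FP (y, [:: e]) (z, [::]))).
Proof.
move=> Wmu muyz ey; have [] // := @is_fmpath_rcons mu (FP (y, [:: e]) (z, [::])) Wmu.
by split=> //; left.
Qed.

Lemma F_felt_rcons mu i (y : vert (E i)) (z : vert (F i)) f :
  is_fmpath v w mu -> mterm mu = Oprod y z -> orig f = z ->
  is_fmpath v w (fmpath_rcons mu (FP (y, [::]) (z, [:: f]))).
Proof.
move=> Wmu muyz ez; have [] // := @is_fmpath_rcons mu (FP (y, [::]) (z, [:: f])) Wmu.
by split=> //; right.
Qed.

(** Each cylinder removed from V(mu lam; B, C) prolongs mu lam by one edge, so [Zset_cat] strips mu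
    from it. Admissibility makes the edges of B and C start at the terminus of [lam]. *)
Lemma Vset_minus_cat mu lam i (y : vert (E i)) (u : vert (F i)) B C z :
  is_fmpath v w mu -> is_fmpath v w lam -> morig lam = mterm mu ->
  mterm lam = Oprod y u -> admissible y B -> admissible u C ->
  Z (FV (mterm mu)) z ->
  Vset_minus (fmpath_cat mu lam) y u B C (pcat mu z) <-> Vset_minus lam y u B C z.
Proof.
move=> Wmu Wlam lammu lamyu [_ By _] [_ Cu _] zmu.
have [_ _ Et] := is_fmpath_cat Wmu Wlam lammu.
have R n : is_felt n -> eorig (elt_of n) = mterm lam ->
    Z (fmpath_rcons (fmpath_cat mu lam) n) (pcat mu z) <-> Z (fmpath_rcons lam n) z.
  move=> Wn nlam; have [Wr or _] := is_fmpath_rcons Wlam Wn nlam.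
  by rewrite (fmpath_rcons_cat _ _ Wmu) Zset_cat// or.
have RD j e : mterm lam = Ou v w j -> D_orig e = Du j ->
    Z (fmpath_rcons (fmpath_cat mu lam) (D_felt e)) (pcat mu z) <->
    Z (fmpath_rcons lam (D_felt e)) z.
  by move=> lamj ej; apply: R => //=; rewrite ej lamj.
have RE e : B e -> Z (fmpath_rcons (fmpath_cat mu lam) (FP (y, [:: e]) (u, [::])))
  (pcat mu z) <->
    Z (fmpath_rcons lam (FP (y, [:: e]) (u, [::]))) z.
  by move=> /By ey; apply: R; rewrite ?lamyu//=; split=> //; left.
have RF f : C f -> Z (fmpath_rcons (fmpath_cat mu lam) (FP (y, [::]) (u, [:: f])))
  (pcat mu z) <->
    Z (fmpath_rcons lam (FP (y, [::]) (u, [:: f]))) z.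
  by move=> /Cu fu; apply: R; rewrite ?lamyu//=; split=> //; right.
rewrite /Vset_minus /Vset /setD /= Et Zset_cat//; split=> -[[H1 H2] H3]; split.
- split=> // j lamj; have := H2 j lamj; apply: contra_not => -[] H; [left|right].
    exact/(RD j).
  exact/(RD j).
- by apply: contra_not H3 => -[] [e He H]; [left|right]; exists e => //;
    [apply/RE|apply/RF].
- split=> // j lamj; have := H2 j lamj; apply: contra_not => -[] H; [left|right].
    exact/(RD j).
  exact/(RD j).
- by apply: contra_not H3 => -[] [e He H]; [left|right]; exists e => //;
    [apply/RE|apply/RF].
Qed.

(** A neighbourhood contains a finite intersection of generating sets, which a filter absorbs. So a
    property of neighbourhoods is proved below by showing that the sets having it form a filter
    [Fl], and by checking the generating sets alone. *)
Lemma pathspace_base_nbhs (Fl : set_system (pathspace v w)) x : Filter Fl ->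
  (forall W, @pathspace_base E F v w W -> W x -> Fl W) ->
  forall U, nbhs x U -> Fl U.
Proof.
move=> FF H U; rewrite nbhsE => -[V [[D sD <-] [W DW Wx]] VU].
apply: (filterS VU); apply: (@filterS _ _ _ W); first by move=> y Wy; exists W.
have [A sA EW] := sD _ DW; move: Wx; rewrite /= -EW => Wx.
by apply: filter_bigI => V' AV'; apply: H; [exact/set_mem/sA|apply: Wx].
Qed.

Lemma pathspace_base_open W : @pathspace_base E F v w W -> open W.
Proof.
move=> bW; exists [set W]; last by rewrite bigcup_set1.
move=> _ ->; exists [fset W]%fset; first by move=> V /fset1P ->; apply/mem_set.
by rewrite set_fset1 bigcap_set1.
Qed.

Lemma open_Zset mu : is_fmpath v w mu -> open (Z mu).
Proof. by move=> Wmu; apply: pathspace_base_open; left; exists mu. Qed.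

Lemma nbhs_Zset mu x : is_fmpath v w mu -> Z mu x -> nbhs x (Z mu).
Proof. by move=> Wmu xmu; apply: open_nbhs_nbhs; split=> //; apply: open_Zset. Qed.

(** Translation by mu carries Z(lam) onto Z(mu lam) and V(lam; B, C) onto V(mu lam; B, C), both
    generating sets. Its injectivity lets images commute with intersections, which makes [Fl] a
    filter. *)
Lemma nbhs_pcat mu z U : is_fmpath v w mu -> Z (FV (mterm mu)) z -> nbhs z U ->
  nbhs (pcat mu z) (pcat mu @` (U `&` Z (FV (mterm mu)))).
Proof.
move=> Wmu zmu.
pose Fl := [set U' | nbhs (pcat mu z) (pcat mu @` (U' `&` Z (FV (mterm mu))))].
have FF : Filter Fl.
  split.
  - apply: filterS (nbhs_Zset Wmu _); last by apply/ZsetP => //; exists z.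
    by move=> x /(ZsetP _ Wmu)[y ymu ->]; exists y.
  - move=> A B FA FB; apply: filterS (@filterI _ (nbhs (pcat mu z)) _ _ _ FA FB) =>
      x [[a [Aa amu] <-]].
    by case=> b [Bb bmu] /(pcat_inj Wmu bmu amu) ba; exists a => //; split=> //;
      split=> //; rewrite -ba.
  - move=> A B AB; rewrite /Fl /=; apply: filterS => x [a [/AB Ba amu] <-].
    by exists a.
apply: (@pathspace_base_nbhs Fl z) => W bW Wz.
have sub lam W' W0 : is_fmpath v w lam -> Z lam z -> W' `<=` Z (fmpath_cat mu lam) ->
    nbhs (pcat mu z) W' ->
    (forall y, Z (FV (mterm mu)) y -> W' (pcat mu y) -> W0 y) -> Fl W0.
  move=> Wlam lamz W'lam nW' H.
  have lammu : morig lam = mterm mu by rewrite -(Zset_orig lamz).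
  rewrite /Fl /=; apply: filterS nW' => x W'x.
  have /(Zset_catP _ Wmu Wlam lammu)[y lamy Ex] := W'lam _ W'x.
  have ymu : Z (FV (mterm mu)) y by rewrite /= (Zset_orig lamy).
  by exists y => //; split=> //; apply: H => //; rewrite -Ex.
case: bW Wz => [[lam Wlam ->]|[lam [i [y [u [B [C [Wlam lamyu aB aC ->]]]]]]]] lamz.
  have lammu : morig lam = mterm mu by rewrite -(Zset_orig lamz).
  apply: (sub lam (Z (fmpath_cat mu lam))) => //.
    by apply: nbhs_Zset; [case: (is_fmpath_cat Wmu Wlam lammu)|apply/Zset_cat].
  by move=> y ymu /Zset_cat; apply.
have lamz' : Z lam z by case: lamz => -[].
have lammu : morig lam = mterm mu by rewrite -(Zset_orig lamz').
have [Wml _ Eml] := is_fmpath_cat Wmu Wlam lammu.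
apply: (sub lam (Vset_minus (fmpath_cat mu lam) y u B C)) => //.
- by move=> x [[]].
- apply: open_nbhs_nbhs; split; last exact/Vset_minus_cat.
  apply: pathspace_base_open; right; exists (fmpath_cat mu lam), i, y, u, B, C.
  by rewrite Eml.
- by move=> x xmu /(Vset_minus_cat Wmu Wlam lammu lamyu aB aC xmu).
Qed.

End Topology.

(** * Cylinders are closed *)

Section Clopen.
Context {E F : bool -> digraph}.
Variables (v : forall i, vert (E i)) (w : forall i, vert (F i)).
Hypotheses (hv : forall i, inf_emitter (E i) (v i))
  (hw : forall i, inf_emitter (F i) (w i)).
Implicit Types (m n : felt E F) (l k : elt E F) (s : seq (felt E F)).
Implicit Types (mu nu lam : fmpath E F) (x y z : pathspace v w).
Implicit Types (U V : set (pathspace v w)).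

Local Notation fterm := (felt_term v w).
Local Notation iorig := (impath_orig v w).
Local Notation morig := (@fmpath_orig E F v w).
Local Notation Z := (@Zset E F v w).

Lemma Zset_felt m x :
  Z (FS [::] m) x <-> exists2 l, impath_elt (sval x) 0 = Some l & elt_ext m l.
Proof. exact: ZsetE. Qed.

(** Only an element of type D can follow one of type (E_i, F_i), and it does so at u_i = (v_i,
    w_i). *)
Lemma linked_emitter i (p : finpath (E i)) (q : finpath (F i)) l :
  linked v w (FP p q) l ->
  inf_emitter (E i) (finpath_term p) /\ inf_emitter (F i) (finpath_term q).
Proof.
case: l => [g|j g h] [] /=.
  case: (gpath_orig g) => j // H _; have ij : i = j := congr1 Overt_index H.
  by subst j; case/Oprod_inj: H => -> ->.
by move=> H []; congr Some; exact: (congr1 Overt_index H).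
Qed.

(** A finite coordinate ends at an infinite emitter in both cases: by definition when the element is
    the last one, and by [linked_emitter] when another follows. *)
Lemma impath_elt0_emitter (x : impath E F) i (g : gpath (E i)) (h : gpath (F i)) :
  is_impath v w x -> impath_elt x 0 = Some (GP g h) ->
  ends_in (inf_emitter (E i)) g /\ ends_in (inf_emitter (F i)) h.
Proof.
have FPeq n : elt_of n = GP g h -> exists p q, [/\ n = FP p q, g = Fin p & h = Fin q].
  case: n => [//|j p q] H; have ij : j = i by case: H.
  by subst j; case/GP_inj: H => <- <-; exists p, q.
case: x => [//|[|n s] l|f] /=.
- by move=> [_ /is_ieltE[_ endl]] [lE]; rewrite lE in endl.
- by case=> -[_ nl _] _ [/FPeq[p [q [En -> ->]]]]; subst n; apply: linked_emitter nl.
- move=> Wf [/FPeq[p [q [En -> ->]]]]; have [_] := Wf 0.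
  by rewrite En => /linked_emitter.
Qed.

Lemma impath_orig_emitter x i (y : vert (E i)) (u : vert (F i)) :
  iorig (sval x) = Oprod y u -> impath_elt (sval x) 0 = None ->
  inf_emitter (E i) y /\ inf_emitter (F i) u.
Proof. by case: x => -[a|[]|] //= Wa ay _; move: Wa; rewrite ay. Qed.

Lemma gpath_ext_edge (G : digraph) (e : edge G) g :
  gpath_ext (orig e, [:: e]) g <-> gpath_orig g = orig e /\ gtake g 1 = [:: e].
Proof. by rewrite gpath_extE /=; split=> -[-> ->]. Qed.

Lemma gpath_edge1 (G : digraph) (g : gpath G) : is_gpath g -> ~ gpath_null g ->
  exists e, gpath_orig g = orig e /\ gtake g 1 = [:: e].
Proof.
case: g => [[a [|e es]]|f] //=; first by case=> oe _ _; exists e; rewrite take0.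
by move=> _ _; exists (f 0).
Qed.

Lemma Zset_D x g : impath_elt (sval x) 0 = Some (GD g) ->
  exists e, gtake g 1 = [:: e] /\ Z (FS [::] (D_felt e)) x.
Proof.
move=> x0; have [Wg g0] := is_gelt_impath_elt (svalP x) x0.
have [e [ge g1]] := gpath_edge1 Wg g0; exists e; split=> //.
by apply/Zset_felt; exists (GD g) => //; apply/gpath_ext_edge.
Qed.

Lemma nbhs_notZ_orig lam x : morig lam <> iorig (sval x) -> nbhs x (~` Z lam).
Proof.
move=> lamx; apply: filterS (@nbhs_Zset _ _ v w (FV (iorig (sval x))) x I _) => //.
by move=> y yx /(Zset_orig) ylam; apply: lamx; rewrite -ylam.
Qed.

(** If [x] starts with an edge of D, the cylinder of that edge separates. Otherwise its origin is
    some u_i, since paths from a_i start in D, and V(u_i) separates: alpha_i and epsilon_i are all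
    the edges of D emitted by u_i. *)
Lemma nbhs_notZ_D e x : ~ Z (FS [::] (D_felt e)) x ->
  nbhs x (~` Z (FS [::] (D_felt e))).
Proof.
move=> xe; have [ex|] := pselect (Overt_of_D v w (D_orig e) = iorig (sval x));
  last first.
  exact: (@nbhs_notZ_orig (FS [::] (D_felt e))).
case: (pselect (exists g, impath_elt (sval x) 0 = Some (GD g))) => [[g x0]|x0].
  have [e' [g1 xe']] := Zset_D x0.
  apply: filterS (nbhs_Zset _ xe') => [y|]; last by [].
  move=> /Zset_felt[l y0 le'] /Zset_felt[l' y0' le]; apply: xe; apply/Zset_felt.
  move: y0; rewrite y0' => -[ll']; subst l'.
  by case: l y0' le le' => // h _ /gpath_ext_edge[_ h1] /gpath_ext_edge[_];
    rewrite h1 => -[ee']; subst e'; apply/Zset_felt.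
have notD e' : ~ Z (FS [::] (D_felt e')) x.
  by move/Zset_felt => [[g|//] x0' _]; apply: x0; exists g.
have [i ei] : exists i, D_orig e = Du i.
  case: (D_orig e) ex => i; first by exists i.
  case: x {xe notD} x0 => -[a|[|n s] l|f] //= Wx x0.
  - by move=> ae; move: Wx; rewrite -ae.
  - by case: l Wx x0 => [g|//] _ [] //; exists g.
  - by case: n Wx x0 => [g|//] _ [] //; exists (Fin g).
  - by case: (f 0) x0 => [g|//] [] //; exists (Fin g).
have Vx : Vset_minus (FV (Ou v w i)) (v i) (w i) set0 set0 x.
  split; last by case=> -[].
  by split=> [|j _]; [rewrite /= -ex ei|case; apply: notD].
apply: filterS (_ : nbhs x (Vset_minus (FV (Ou v w i)) (v i) (w i) set0 set0)).
  move=> y [[_ /(_ i erefl) H] _] ye; apply: H.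
  case: e ei ye {xe ex} => j //= [->] ye; by [left|right].
apply: open_nbhs_nbhs; split=> //; apply: pathspace_base_open; right.
by exists (FV (Ou v w i)), i, (v i), (w i), set0, set0; split=> //; split.
Qed.

(* A path with the origin of [e] that does not start with [e] either starts with
   another edge of [D] or of [E_i], or has no edge of [E_i] in its first element;
   then [orig e] is an infinite emitter, so [e] may be excluded in a [V]. *)
Lemma nbhs_notZ_E i (e : edge (E i)) (u : vert (F i)) x :
  let m := FP (orig e, [:: e]) (u, [::]) in
  ~ Z (FS [::] m) x -> nbhs x (~` Z (FS [::] m)).
Proof.
move=> m xm.
have [ex|] := pselect (Oprod (orig e) u = iorig (sval x));
  last exact: (@nbhs_notZ_orig (FS [::] m)).
case: (pselect (exists g, impath_elt (sval x) 0 = Some (GD g))) => [[g x0]|nD].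
  have [e' [_ xe']] := Zset_D x0.
  apply: filterS (nbhs_Zset _ xe') => [y|]; last by [].
  by move=> /Zset_felt[l y0 le'] /Zset_felt[l' + le]; rewrite y0 => -[ll']; subst l';
    have := elt_ext_type le; rewrite -(elt_ext_type le').
have Vok : inf_emitter (E i) (orig e) -> nbhs x (~` Z (FS [::] m)).
  move=> ye.
  apply: filterS (_ : nbhs x (Vset_minus (FV (Oprod (orig e) u)) (orig e) u [set e]
    set0)).
    by move=> y [_ H] ym; apply: H; left; exists e.
  apply: open_nbhs_nbhs; split.
    apply: pathspace_base_open; right.
    exists (FV (Oprod (orig e) u)), i, (orig e), u, [set e], set0.
    by split=> //; split=> // _ ->.
  split; last by case=> -[] // _ -> .
  split=> //= j _; have notD e' : ~ Z (FS [::] (D_felt e')) x.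
    by move/Zset_felt => [[g|//] x0' _]; apply: nD; exists g.
  by case; apply: notD.
case x0: (impath_elt (sval x) 0) => [l|]; last first.
  by apply: Vok; have [] := impath_orig_emitter (esym ex) x0.
have ol := impath_elt0_orig v w x0.
case: l x0 ol => [g|j g h] x0 /=; first by case: nD; exists g.
rewrite -ex => ol; have ij : i = j := congr1 Overt_index (esym ol).
subst j; case/Oprod_inj: ol => og oh.
have [Wg _ _] := is_gelt_impath_elt (svalP x) x0.
have [g0|g0] := pselect (gpath_null g).
  apply: Vok; have [+ _] := impath_elt0_emitter (svalP x) x0.
  by rewrite (gpath_null_inj g0) og.
have [e' [oe' g1]] := gpath_edge1 Wg g0.
have xe' : Z (FS [::] (FP (orig e', [:: e']) (u, [::]))) x.
  apply/Zset_felt; exists (GP g h) => //; rewrite elt_extP; split;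
    first exact/gpath_ext_edge.
  exact/gpath_ext_null.
apply: filterS (nbhs_Zset _ xe') => [y|]; last by split=> //; split=> //; left.
move=> /Zset_felt[l y0 le'] /Zset_felt[l' y0' le]; apply: xm.
move: y0; rewrite y0' => -[ll']; subst l'.
have tl := elt_ext_type le; case: l y0' le le' tl => // j g' h' y0 + + tl.
have ij : i = j by case: tl.
subst j; rewrite !elt_extP => -[/gpath_ext_edge[_ h1] _] [/gpath_ext_edge[_ +] _].
by rewrite h1 => -[ee']; rewrite /m ee'.
Qed.

Lemma nbhs_notZ_F i (y : vert (E i)) (f : edge (F i)) x :
  let m := FP (y, [::]) (orig f, [:: f]) in
  ~ Z (FS [::] m) x -> nbhs x (~` Z (FS [::] m)).
Proof.
move=> m xm.
have [fx|] := pselect (Oprod y (orig f) = iorig (sval x));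
  last exact: (@nbhs_notZ_orig (FS [::] m)).
case: (pselect (exists g, impath_elt (sval x) 0 = Some (GD g))) => [[g x0]|nD].
  have [e' [_ xe']] := Zset_D x0.
  apply: filterS (nbhs_Zset _ xe') => [z|]; last by [].
  by move=> /Zset_felt[l z0 le'] /Zset_felt[l' + le]; rewrite z0 => -[ll']; subst l';
    have := elt_ext_type le; rewrite -(elt_ext_type le').
have Vok : inf_emitter (F i) (orig f) -> nbhs x (~` Z (FS [::] m)).
  move=> yf.
  apply: filterS (_ : nbhs x (Vset_minus (FV (Oprod y (orig f))) y (orig f) set0
    [set f])).
    by move=> z [_ H] zm; apply: H; right; exists f.
  apply: open_nbhs_nbhs; split.
    apply: pathspace_base_open; right.
    exists (FV (Oprod y (orig f))), i, y, (orig f), set0, [set f].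
    by split=> //; split=> // _ ->.
  split; last by case=> -[] // _ -> .
  split=> //= j _; have notD e' : ~ Z (FS [::] (D_felt e')) x.
    by move/Zset_felt => [[g|//] x0' _]; apply: nD; exists g.
  by case; apply: notD.
case x0: (impath_elt (sval x) 0) => [l|]; last first.
  by apply: Vok; have [] := impath_orig_emitter (esym fx) x0.
have ol := impath_elt0_orig v w x0.
case: l x0 ol => [g|j g h] x0 /=; first by case: nD; exists g.
rewrite -fx => ol; have ij : i = j := congr1 Overt_index (esym ol).
subst j; case/Oprod_inj: ol => og oh.
have [_ Wh _] := is_gelt_impath_elt (svalP x) x0.
have [h0|h0] := pselect (gpath_null h).
  apply: Vok; have [_ +] := impath_elt0_emitter (svalP x) x0.
  by rewrite (gpath_null_inj h0) oh.
have [f' [of' h1]] := gpath_edge1 Wh h0.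
have xf' : Z (FS [::] (FP (y, [::]) (orig f', [:: f']))) x.
  apply/Zset_felt; exists (GP g h) => //; rewrite elt_extP; split;
    last exact/gpath_ext_edge.
  exact/gpath_ext_null.
apply: filterS (nbhs_Zset _ xf') => [z|]; last by split=> //; split=> //; right.
move=> /Zset_felt[l z0 lf'] /Zset_felt[l' z0' lf]; apply: xm.
move: z0; rewrite z0' => -[ll']; subst l'.
have tl := elt_ext_type lf; case: l z0' lf lf' tl => // j g' h' z0 + + tl.
have ij : i = j by case: tl.
subst j; rewrite !elt_extP => -[_ /gpath_ext_edge[_ H]] [_ /gpath_ext_edge[_ +]].
by rewrite H => -[ff']; rewrite /m ff'.
Qed.

Definition Z_closed lam := forall x, ~ Z lam x -> nbhs x (~` Z lam).

(** A path outside Z(m nu) is outside Z(m), or is m z with z outside Z(nu); in the second case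
    translation by m, being open, transports a neighbourhood of z. *)
Lemma Z_closed_cons m nu : is_felt m -> is_fmpath v w nu -> morig nu = fterm m ->
  Z_closed (FS [::] m) -> Z_closed nu -> Z_closed (fmpath_cons m nu).
Proof.
move=> Wm Wnu num Cm Cnu x xmnu.
have [xm|xm] := pselect (Z (FS [::] m) x); last first.
  apply: filterS (Cm _ xm) => y ym; apply: contra_not ym => /ZsetE H; apply/ZsetE.
  exact: (impath_ext_consW Wm Wnu num (svalP y) H).
have W1 : is_fmpath v w (FS [::] m) by [].
have [z zm Ex] := proj1 (ZsetP hv hw x W1) xm.
have znu : ~ Z nu z.
  by move=> znu; apply: xmnu; apply/(@Zset_catP _ _ v w hv hw (FS [::] m) nu) =>
    //; exists z.
rewrite Ex; apply: filterS (nbhs_pcat hv hw W1 zm (Cnu _ znu)).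
move=> _ [y [ynu ym] <-]; apply: contra_not ynu => H.
exact/(@Zset_cat _ _ v w hv hw (FS [::] m) nu).
Qed.

(** Reduction to single edges by [Z_closed_cons]. A product element (p, q) is factored as p in the
    first coordinate followed by q in the second. *)
Lemma Z_closed_felt m : is_felt m -> Z_closed (FS [::] m).
Proof.
have CD p : is_finpath p -> 0 < finpath_len p -> Z_closed (FS [::] (FD p)).
  case: p => a es; rewrite /is_finpath /finpath_len /=.
  elim: es a => [//|e [_|e' es IH]] a [<- W] _; first by move=> x; apply: nbhs_notZ_D.
  apply: (@Z_closed_cons (D_felt e) (FS [::] (FD (D_term e, e' :: es)))) => //.
    by move=> x; apply: nbhs_notZ_D.
  exact: IH.
have CE i (p : finpath (E i)) u : is_finpath p -> 0 < finpath_len p ->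
    Z_closed (FS [::] (FP p (u, [::]))).
  case: p => a es; rewrite /is_finpath /finpath_len /=.
  elim: es a => [//|e [_|e' es IH]] a [<- W] _; first by move=> x; apply: nbhs_notZ_E.
  have -> : FS [::] (FP (orig e, [:: e, e' & es]) (u, [::])) =
    fmpath_cons (FP (orig e, [:: e]) (u, [::])) (FS [::] (FP (term e, e' :: es) (u,
      [::]))).
    by case: (i) e e' es u {IH W}.
  apply: Z_closed_cons => //.
  - by split=> //; left.
  - by split=> //; split=> //; left.
  - by move=> x; apply: nbhs_notZ_E.
  - exact: IH.
have CF i (a : vert (E i)) (q : finpath (F i)) : is_finpath q -> 0 < finpath_len q ->
    Z_closed (FS [::] (FP (a, [::]) q)).
  case: q => u es; rewrite /is_finpath /finpath_len /=.
  elim: es u => [//|e [_|e' es IH]] u [<- W] _; first by move=> x; apply: nbhs_notZ_F.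
  have -> : FS [::] (FP (a, [::]) (orig e, [:: e, e' & es])) =
    fmpath_cons (FP (a, [::]) (orig e, [:: e])) (FS [::] (FP (a, [::]) (term e, e'
      :: es))).
    by case: (i) e e' es a {IH W}.
  apply: Z_closed_cons => //.
  - by split=> //; right.
  - by split=> //; split=> //; right.
  - by move=> x; apply: nbhs_notZ_F.
  - exact: IH.
case: m => [p [Wp p0]|i p q [Wp Wq pq0]]; first exact: CD.
have [p0|p0] := posnP (finpath_len p).
  rewrite p0 in pq0; case: pq0 => // q0; have -> : p = (p.1, [::]).
    by case: p p0 {Wp} => b [].
  exact: CF.
have [q0|q0] := posnP (finpath_len q).
  have -> : q = (q.1, [::]) by case: q q0 {Wq pq0} => b [].
  exact: CE.
have -> : FS [::] (FP p q) =
  fmpath_cons (FP p (q.1, [::])) (FS [::] (FP (finpath_term p, [::]) q)).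
  by case: i p q {Wp Wq pq0 p0 q0} => p [b es]; rewrite /= /finpath_cat /= cats0;
    case: p.
apply: Z_closed_cons => //.
- by split=> //; left.
- by split=> //; split=> //; right.
- exact: CE.
- exact: CF.
Qed.

Lemma Zset_closed lam : is_fmpath v w lam -> Z_closed lam.
Proof.
elim/(@fmpath_ind_cons E F v w) => [a x xa|m nu Wm Wnu num].
  by apply: nbhs_notZ_orig => ax; apply: xa.
by apply: Z_closed_cons => //; exact: Z_closed_felt.
Qed.

Lemma nbhs_Zset_iff lam x : is_fmpath v w lam -> nbhs x [set y | Z lam y <-> Z lam x].
Proof.
move=> Wlam; have [xlam|xlam] := pselect (Z lam x).
  by apply: filterS (nbhs_Zset Wlam xlam) => y ylam; split.
by apply: filterS (Zset_closed Wlam xlam) => y ylam; split.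
Qed.

End Clopen.

(** * Translation by a finite path is continuous *)

Section Continuity.
Context {E F : bool -> digraph}.
Variables (v : forall i, vert (E i)) (w : forall i, vert (F i)).
Hypotheses (hv : forall i, inf_emitter (E i) (v i))
  (hw : forall i, inf_emitter (F i) (w i)).
Implicit Types (m n : felt E F) (l k : elt E F) (s : seq (felt E F)).
Implicit Types (mu nu lam : fmpath E F) (x y z : pathspace v w).
Implicit Types (U V : set (pathspace v w)).

Local Notation fterm := (felt_term v w).
Local Notation mterm := (fmpath_term v w).
Local Notation Z := (@Zset E F v w).

Lemma filter_finite_set (T J : Type) (Fl : set_system T) (B : set J) (P : J -> set T) :
  Filter Fl -> finite_set B -> (forall j, B j -> Fl (P j)) ->
  Fl [set t | forall j, B j -> P j t].
Proof.
move=> FF /(@finite_fsetP {classic J})[A ->] H.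
by apply: filterS (@filter_bigI _ {classic J} A P Fl FF _).
Qed.

(* The sets [Z mu] are clopen and generate the topology with their complements,
   so convergence may be tested on them. *)
Lemma Zset_filter_nbhs (Fl : set_system (pathspace v w)) x : Filter Fl ->
  (forall lam, is_fmpath v w lam -> Fl [set y | Z lam y <-> Z lam x]) ->
  forall U, nbhs x U -> Fl U.
Proof.
move=> FF H; apply: pathspace_base_nbhs => W bW Wx.
have pos lam : is_fmpath v w lam -> Z lam x -> Fl (Z lam).
  by move=> Wlam xlam; apply: filterS (H _ Wlam) => y [_]; apply.
have neg lam : is_fmpath v w lam -> ~ Z lam x -> Fl (~` Z lam).
  by move=> Wlam xlam; apply: filterS (H _ Wlam) => y [? _] /=; tauto.
case: bW Wx => [[lam Wlam ->]|[lam [i [a [u [B [C [Wlam lamau aB aC ->]]]]]]]].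
  exact: pos.
case=> -[xlam xV] xBC.
have VD : Fl [set y | forall j, setT j -> mterm lam = Ou v w j ->
    ~ (Z (fmpath_rcons lam (D_felt (Dalpha j))) `|`
       Z (fmpath_rcons lam (D_felt (Depsilon j)))) y].
  apply: filter_finite_set => // j _.
  have [lamj|lamj] := pselect (mterm lam = Ou v w j); last by apply: filterE => y /lamj.
  have := xV j lamj; rewrite /setU /= => /not_orP[xa xe].
  apply: filterS (filterI (neg _ _ xa) (neg _ _ xe)).
  - by move=> y [ya ye] _ [].
  - exact: D_felt_rcons lamj _.
  - exact: D_felt_rcons lamj _.
have [fB By _] := aB; have [fC Cu _] := aC.
have VB : Fl [set y | forall e, B e ->
    (~` Z (fmpath_rcons lam (FP (a, [:: e]) (u, [::])))) y].
  apply: filter_finite_set => // e Be; apply: neg.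
    exact: (E_felt_rcons Wlam lamau (By _ Be)).
  by move=> xe; apply: xBC; left; exists e.
have VC : Fl [set y | forall f, C f ->
    (~` Z (fmpath_rcons lam (FP (a, [::]) (u, [:: f])))) y].
  apply: filter_finite_set => // f Cf; apply: neg.
    exact: (F_felt_rcons Wlam lamau (Cu _ Cf)).
  by move=> xf; apply: xBC; right; exists f.
apply: filterS (filterI (pos _ Wlam xlam) (filterI VD (filterI VB VC))).
move=> y [ylam [yD [yB yC]]]; split; last by case=> -[j jBC]; [apply: yB|apply: yC].
by split=> // j; apply: yD.
Qed.

(** Induction on [mu] leaves a single element [m]. There continuity is tested on cylinders, whose
    preimages are empty or cylinders by [impath_ext_residual], hence clopen. *)
Lemma nbhs_pcat_preimage mu z U : is_fmpath v w mu -> Z (FV (mterm mu)) z ->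
  nbhs (pcat mu z) U -> nbhs z [set y | Z (FV (mterm mu)) y -> U (pcat mu y)].
Proof.
move=> Wmu; elim/(@fmpath_ind_cons E F v w): Wmu z U => [a|m nu Wm Wnu num IH] z U zmu.
  have E0 y : pcat (FV a) y = y.
    by apply: pathspace_eq; rewrite /pcat; case: pselect.
  by rewrite E0; apply: filterS => y Uy _; rewrite E0.
have [_ _ Et] := is_fmpath_cons Wm Wnu num; rewrite Et in zmu *.
have W1 : is_fmpath v w (FS [::] m) by [].
have pE y : Z (FV (mterm nu)) y -> pcat (fmpath_cons m nu) y = pcat (FS [::] m)
  (pcat nu y).
  exact: (@pcat_cat _ _ v w hv hw (FS [::] m) nu).
have orig y : Z (FV (mterm nu)) y -> Z (FV (fterm m)) (pcat nu y).
  move=> ynu; rewrite /= sval_pcat//.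
  by have [_ ->] := is_impath_cat hv hw Wnu (svalP y) ynu.
rewrite pE// => nU.
suff : nbhs (pcat nu z) [set y | Z (FV (fterm m)) y -> U (pcat (FS [::] m) y)].
  move/(IH z _ zmu); apply: filterS => y H ynu; rewrite pE//.
  by apply: H => //; apply: orig.
move: (pcat nu z) (orig _ zmu) nU => {IH pE orig zmu}t tm.
pose Fl := [set U' | nbhs t [set y | Z (FV (fterm m)) y -> U' (pcat (FS [::] m) y)]].
have FF : Filter Fl.
  split.
  - by rewrite /Fl /=; apply: filterE => y ym.
  - move=> A B FA FB; apply: filterS (@filterI _ (nbhs t) _ _ _ FA FB) => y [HA HB] ym.
    by split; [apply: HA|apply: HB].
  - by move=> A B AB; rewrite /Fl /=; apply: filterS => y H ym; apply/AB/H.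
apply: (@Zset_filter_nbhs Fl _) => lam Wlam; rewrite /Fl /=.
have catE y : Z (FV (fterm m)) y -> sval (pcat (FS [::] m) y) = impath_cons m (sval y).
  by move=> ym; rewrite sval_pcat.
have [H|[lam' [Wlam' _ H]]] := impath_ext_residual hv hw Wm Wlam.
  apply: filterE => y ym; split=> /ZsetE; rewrite catE// => H'; exfalso.
    exact: (H _ (svalP y) ym H').
  exact: (H _ (svalP t) tm H').
apply: filterS (nbhs_Zset_iff hv hw t Wlam') => y /= + ym.
by rewrite !ZsetE !catE// !H//; exact: svalP.
Qed.

End Continuity.

(** * Irreducibility of the mixed graph, and cylinders inside open sets *)

Section Density.
Context {E F : bool -> digraph}.
Variables (v : forall i, vert (E i)) (w : forall i, vert (F i)).
Hypotheses (hv : forall i, inf_emitter (E i) (v i))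
  (hw : forall i, inf_emitter (F i) (w i)).
Hypotheses (hEirr : forall i, irreducible (E i)) (hFirr : forall i, irreducible (F i)).
Implicit Types (m n : felt E F) (l k : elt E F) (s : seq (felt E F)).
Implicit Types (mu nu lam : fmpath E F) (a b : Overt E F).

Local Notation fterm := (felt_term v w).
Local Notation eorig := (elt_orig v w).
Local Notation iorig := (impath_orig v w).
Local Notation morig := (@fmpath_orig E F v w).
Local Notation mterm := (fmpath_term v w).
Local Notation Z := (@Zset E F v w).

Local Arguments mkseq : simpl never.

Definition connected_to a b :=
  exists mu, [/\ is_fmpath v w mu, morig mu = a & mterm mu = b].

Lemma connected_trans a b c : connected_to a b -> connected_to b c -> connected_to a c.
Proof.
move=> [mu [Wmu mua mub]] [nu [Wnu nub nuc]]; exists (fmpath_cat mu nu).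
have numu : morig nu = mterm mu by rewrite mub nub.
by have [W -> ->] := is_fmpath_cat Wmu Wnu numu.
Qed.

Lemma connected_D (e : D_edge) :
  connected_to (Overt_of_D v w (D_orig e)) (Overt_of_D v w (D_term e)).
Proof. by exists (FS [::] (D_felt e)). Qed.

Lemma connected_prod i (y y' : vert (E i)) (u u' : vert (F i)) :
  connected_to (Oprod y u) (Oprod y' u').
Proof.
have [p [Wp <- <-]] := hEirr y y'; have [q [Wq <- <-]] := hFirr u u'.
have [[p0 q0]|pq0] := pselect (p.2 = [::] /\ q.2 = [::]).
  exists (FV (Oprod p.1 q.1)); split=> //=.
  by rewrite /finpath_term p0 q0.
exists (FS [::] (FP p q)); split=> //; split=> //; split=> //; rewrite /finpath_len.
case: (p.2) pq0 => [|? ?] pq0; last by left.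
by case: (q.2) pq0 => [[] //|? ?] _; right.
Qed.

(** Every vertex leads to some u_i and is reached from some u_j: inside a product by irreducibility
    of both factors, for a_i by the edges delta_i and alpha_i. The edges epsilon_0, epsilon_1 join
    the two u_i. *)
Lemma connected a b : connected_to a b.
Proof.
have uu i j : connected_to (Ou v w i) (Ou v w j).
  have [<-|ij] := eqVneq i j; first by exists (FV (Ou v w i)).
  by have -> : j = ~~ i; [case: (i) (j) ij => -[]|exact: (connected_D (Depsilon i))].
have au : exists i, connected_to a (Ou v w i).
  case: a => [i y u|i]; first by exists i; apply: connected_prod.
  by exists (~~ i); apply: (connected_D (Ddelta i)).
have ub : exists i, connected_to (Ou v w i) b.
  case: b => [i y u|i]; first by exists i; apply: connected_prod.
  by exists i; apply: (connected_D (Dalpha i)).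
have [i ai] := au; have [j jb] := ub.
exact: connected_trans ai (connected_trans (uu i j) jb).
Qed.

Lemma impath_IV_Ou i : is_impath v w (IV (Ou v w i)).
Proof. by []. Qed.

(** An infinite path is cut after N+1 edges and then led into [S]; tests of at most N edges do not
    notice. With N+1 edges the result is not null even for N = 0. *)
Lemma gpath_truncate (G : digraph) (S : set (vert G)) (g : gpath G) N :
  (forall y, exists p, [/\ is_finpath p, p.1 = y & S (finpath_term p)]) ->
  is_gpath g -> ends_in S g ->
  exists q, [/\ is_finpath q, q.1 = gpath_orig g, S (finpath_term q),
    gpath_null (Fin q) -> gpath_null g &
    forall r : finpath G, size r.2 <= N -> gpath_ext r g <-> gpath_ext r (Fin q)].
Proof.
move=> toS; case: g => [q|f] Wg Sg; first by exists q.
have [p [Wp p1 Sp]] := toS (term (f N)).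
pose q0 : finpath G := (orig (f 0), mkseq f N.+1).
have q0f : gpath_ext q0 (Inf f) by apply/gpath_extE; split=> //;
  rewrite /q0 /snd size_mkseq.
have pq0 : p.1 = finpath_term q0 by rewrite p1 /finpath_term last_term_mkseq.
have Wq0 := is_finpath_ext Wg q0f.
exists (finpath_cat q0 p); split=> //.
- exact: is_finpath_cat.
- by rewrite finpath_term_cat.
move=> l lN; rewrite -[Fin _]/(gpath_cat q0 (Fin p)) !gpath_extE gpath_orig_cat//
  gtake_cat /=.
have -> : size l.2 - size (mkseq f N.+1) = 0.
  by apply/eqP; rewrite size_mkseq subn_eq0 (leq_trans lN).
rewrite take0 cats0 /mkseq -map_take take_iota.
by rewrite (minn_idPl (leq_trans lN (leqnSn N))).
Qed.

(** The admissible ends can be reached from everywhere: in D by an edge delta_i, in E_i and F_i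
    because irreducibility leads to v_i and w_i. *)
Lemma elt_truncate l N : is_ielt l ->
  exists m, [/\ is_felt m, elt_ends (elt_of m), eorig (elt_of m) = eorig l,
    elt_type (elt_of m) = elt_type l &
    forall n, (felt_len n).1 + (felt_len n).2 <= N ->
      elt_ext n l <-> elt_ext n (elt_of m)].
Proof.
move=> /is_ieltE[]; case: l => [g [Wg g0] endg|i g h [Wg Wh gh0] [endg endh]].
  have toD (y : vert Dgraph) : exists p : finpath Dgraph,
      [/\ is_finpath p, p.1 = y & range Du (finpath_term p)].
    case: y => i; first by exists (Du i, [::]); split=> //; exists i.
    by exists (Da i, [:: Ddelta i]); split=> //; exists (~~ i).
  have [q [Wq qg endq q0 H]] := gpath_truncate N toD Wg endg.
  exists (FD q); split=> //; first by apply/is_feltE; split=> // /q0.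
    by rewrite /= qg.
  move=> n nN; case: n nN => [p pN|j p p' _]; last by case: j p p'.
  by apply: H; exact: leq_trans (leq_addr _ _) pN.
have toE (y : vert (E i)) : exists p,
    [/\ is_finpath p, p.1 = y & inf_emitter (E i) (finpath_term p)].
  by have [p [Wp p1 pv]] := hEirr y (v i); exists p; rewrite pv.
have toF (y : vert (F i)) : exists p,
    [/\ is_finpath p, p.1 = y & inf_emitter (F i) (finpath_term p)].
  by have [p [Wp p1 pv]] := hFirr y (w i); exists p; rewrite pv.
have [p [Wp pg endp p0 H]] := gpath_truncate N toE Wg endg.
have [q [Wq qh endq q0 H']] := gpath_truncate N toF Wh endh.
exists (FP p q); split=> //.
- by apply/is_feltE; split=> // -[/p0 g0 /q0 h0]; apply: gh0.
- by rewrite /= pg qh.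
case=> [//|j r r' rN].
have [ij|ij] := pselect (j = i); last first.
  by split=> /elt_ext_type tj; case: ij; case: tj.
subst j; rewrite /elt_of !elt_extP H ?H'//.
  exact: leq_trans (leq_addl _ _) rN.
exact: leq_trans (leq_addr _ _) rN.
Qed.

Lemma linked_string_last s l l' : eorig l = eorig l' -> elt_type l = elt_type l' ->
  linked_string v w s l -> linked_string v w s l'.
Proof.
move=> ol tl; elim: s => [//|n s IH] /= [Wn nl Ws]; split=> //; last exact: IH.
by case: s nl {IH Ws} => //=; rewrite /linked ol tl.
Qed.

Lemma impath_cat_IV s m a : is_fmpath v w (FS s m) ->
  impath_cat (FS s m) (IV a) = IS s (elt_of m).
Proof.
elim: s => [//|n s IH] Ws; have [_ Wss _ ->] := fmpath_cons_string Ws.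
rewrite impath_cat_cons IH//; case: Ws => -[_ + _] _.
by case: s {IH Wss} => [|n' s] [_ /elt_merge_none] /= => [->//|];
  rewrite elt_merge_of; case: felt_merge.
Qed.

Lemma stream_ext_head s m (X : nat -> option (elt E F)) :
  stream_ext s m X -> X 0 <> None.
Proof. by case: s => [[l ->]|n s [->]]. Qed.

(** How deep a test with [mu] looks: a bound limits both the number of elements inspected and the
    length of the last one. The elements before the last are compared for equality, so their lengths
    are not counted. *)
Definition fmpath_size mu : nat :=
  if mu is FS s m then size s + ((felt_len m).1 + (felt_len m).2) else 0.

Lemma impath_ext_last s l l' mu N : eorig l = eorig l' ->
  (forall n, (felt_len n).1 + (felt_len n).2 <= N -> elt_ext n l <-> elt_ext n l') ->
  fmpath_size mu <= N ->
  impath_ext v w mu (IS s l) <-> impath_ext v w mu (IS s l').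
Proof.
move=> ol H; case: mu => [a|s' m] sN; first by case: s => //=; rewrite ol.
have {sN} /H Hm : (felt_len m).1 + (felt_len m).2 <= N.
  exact: leq_trans (leq_addl _ _) sN.
rewrite /impath_ext.
elim: s s' => [|n s IH] [|n' s'] /=.
- by split=> -[_ [<-]] /Hm ?; eexists; eauto.
- by split=> -[_ /stream_ext_head].
- by [].
- by split=> -[-> /IH].
Qed.

(** Both sequences begin with the complete elements of [s]. The strict inequality keeps the last
    tested element within these, away from the one that extends [m], where the sequences may
    differ. *)
Lemma stream_ext_prefix s m s' m' (X Y : nat -> option (elt E F)) :
  stream_ext s m X -> stream_ext s m Y -> size s' < size s ->
  stream_ext s' m' X -> stream_ext s' m' Y.
Proof.
elim: s s' X Y => [//|n s IH] [|n' s'] X Y [X0 HX] [Y0 HY] lt_s.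
  by case=> l; rewrite X0 => -[<-] H; exists (elt_of n).
by case=> + H; rewrite /= X0 Y0 => ->; split=> //; apply: IH HX HY _ H.
Qed.

Lemma linked_string_II (f : nat -> felt E F) N : is_impath v w (II f) ->
  linked_string v w (mkseq f N) (elt_of (f N)).
Proof.
elim: N f => [//|N IH] f Wf.
have -> : mkseq f N.+1 = f 0 :: mkseq (fun j => f j.+1) N.
  by rewrite /mkseq /= (iotaDl 1 0) -map_comp.
split; last by apply: (IH (fun j => f j.+1)) => j; apply: Wf.
  by case: (Wf 0).
by case: N {IH} => [|N]; case: (Wf 0).
Qed.

Lemma stream_ext_II (f : nat -> felt E F) N : stream_ext (mkseq f N) (f N)
  (impath_elt (II f)).
Proof.
elim: N f => [|N IH] f; first by exists (elt_of (f 0)) => //; apply: elt_ext_refl.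
have -> : mkseq f N.+1 = f 0 :: mkseq (fun j => f j.+1) N.
  by rewrite /mkseq /= (iotaDl 1 0) -map_comp.
by split=> //; apply: (IH (fun j => f j.+1)).
Qed.

(* Paths of the form [nu a], with [a] a vertex in some [L_i * M_i], are dense. *)
Lemma impath_truncate (x : impath E F) N : is_impath v w x ->
  exists nu a, [/\ is_fmpath v w nu, is_impath v w (IV a), mterm nu = a &
    forall lam, fmpath_size lam <= N ->
      impath_ext v w lam x <-> impath_ext v w lam (impath_cat nu (IV a))].
Proof.
case: x => [a|s l|f] Wx.
- by exists (FV a), a.
- have [Ws Wl] := Wx; have [m [Wm endm om tm H]] := elt_truncate N Wl.
  exists (FS s m), (fterm m).
  have Wsm : is_fmpath v w (FS s m).
    by split=> //; apply: linked_string_last Ws.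
  split=> //; first exact/(elt_ends_term hv hw).
  move=> lam lamN; rewrite impath_cat_IV//.
  exact: (impath_ext_last s (esym om) H lamN).
(* A test of size at most N inspects at most the first N+1 elements, which are complete in [nu]. The
   extra element [f N.+1] absorbs a possible merge with the path [rho] leading to u_0. *)
pose nu := FS (mkseq f N.+1) (f N.+1).
have Wnu : is_fmpath v w nu.
  by split; [exact: linked_string_II|case: (Wx N.+1)].
have [rho [Wrho rhoo rhot]] := connected (fterm (f N.+1)) (Ou v w false).
have [Wc oc tc] := is_fmpath_cat Wnu Wrho rhoo.
exists (fmpath_cat nu rho), (Ou v w false); rewrite tc; split=> //.
have Wy := is_impath_cat hv hw Wc (impath_IV_Ou false) (esym (etrans tc rhot)).
have xnu := stream_ext_II f N.+1.
have ynu : impath_ext v w nu (impath_cat (fmpath_cat nu rho) (IV (Ou v w false))).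
  have Wr := is_impath_cat hv hw Wrho (impath_IV_Ou false) (esym rhot).
  rewrite (impath_catA _ _ Wnu) -[X in impath_ext _ _ X](fmpath_cat_FV Wnu).
  rewrite (impath_ext_catP hv hw Wnu)//; last first.
    by rewrite -(impath_catA _ _ Wnu); case: Wy.
  case: Wr => Wr; rewrite rhoo => or.
  by exists (impath_cat rho (IV (Ou v w false))).
case=> [a|s m] sN.
  have xy : iorig (II f) = iorig (impath_cat (fmpath_cat nu rho) (IV (Ou v w false))).
    by rewrite (impath_ext_orig ynu) -(@impath_ext_orig _ _ v w nu (II f) xnu).
  by rewrite /impath_ext xy.
have sN' : size s < size (mkseq f N.+1).
  by rewrite size_mkseq ltnS (leq_trans _ sN)// leq_addr.
by split; [apply: stream_ext_prefix xnu ynu sN'|apply: stream_ext_prefix ynu xnu sN'].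
Qed.

Lemma finite_bad_edges (G : digraph) (p : finpath G) :
  finite_set [set e | ohead p.2 = Some e].
Proof.
case: p => a [|e es] /=; first by rewrite (_ : [set _ | _] = set0)//; apply/seteqP;
  split.
rewrite (_ : [set _ | _] = [set e])//; apply/seteqP; split=> e' /=; first by case.
by move=> ->.
Qed.

(** A neighbourhood of a vertex path rules out only finitely many first edges in each coordinate,
    and infinitely many are available. Both e and f are prescribed because a test (p, q) with p null
    can be defeated only by f, and conversely. *)
Lemma nbhs_IV (x : pathspace v w) U i (y : vert (E i)) (u : vert (F i)) :
  sval x = IV (Oprod y u) -> nbhs x U ->
  exists e f, [/\ orig e = y, orig f = u &
    Z (FS [::] (FP (y, [:: e]) (u, [:: f]))) `<=` U].
Proof.
move=> Ex.
pose Fl := [set U' : set (pathspace v w) | exists B C, [/\ finite_set B, finite_set C &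
  forall e f, orig e = y -> orig f = u -> ~ B e -> ~ C f ->
    Z (FS [::] (FP (y, [:: e]) (u, [:: f]))) `<=` U']].
have FF : Filter Fl.
  split.
  - by exists set0, set0; split.
  - move=> U1 U2 [B [C [fB fC H]]] [B' [C' [fB' fC' H']]].
    exists (B `|` B'), (C `|` C'); split; rewrite ?finite_setU//.
    move=> e f ey fu /not_orP[nB nB'] /not_orP[nC nC'].
    by move=> t Ht; split; [apply: H Ht|apply: H' Ht].
  - move=> U1 U2 U12 [B [C [fB fC H]]]; exists B, C; split=> // e f ey fu nB nC.
    exact: subset_trans (H _ _ ey fu nB nC) U12.
move=> xU; have : Fl U.
  move: U xU; apply: Zset_filter_nbhs => lam Wlam.
  case: lam Wlam => [a _|s m Wsm].
    exists set0, set0; split=> // e f ey fu _ _ t /Zset_orig /= tyu.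
    by rewrite tyu Ex.
  have xsm : ~ Z (FS s m) x.
    by move/ZsetE/stream_ext_head; rewrite Ex.
  pose n := head m s.
  have Wn : is_felt n by rewrite /n; case: (s) Wsm => [|n' s'] [] // [].
  have tn t : Z (FS s m) t -> exists2 l, impath_elt (sval t) 0 = Some l & elt_ext n l.
    move/ZsetE; rewrite /n; case: (s) => [//|n' s'] [t0 _].
    by exists (elt_of n') => //; apply: elt_ext_refl.
  suff [B [C [fB fC H]]] : exists (B : set (edge (E i))) (C : set (edge (F i))),
      [/\ finite_set B, finite_set C & forall e f l, ~ B e -> ~ C f ->
        elt_ext (FP (y, [:: e]) (u, [:: f])) l -> ~ elt_ext n l].
    exists B, C; split=> // e f ey fu nB nC t /Zset_felt[l t0 tl].
    split=> // /tn[l']; rewrite t0 => -[<-] nl.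
    by case: (H _ _ _ nB nC tl).
  case: n Wn {tn} => [p _|j p q [Wp Wq pq0]].
    exists set0, set0; split=> // e f l _ _ /elt_ext_type tl /elt_ext_type.
    by rewrite -tl.
  have [ij|ij] := pselect (j = i); last first.
    exists set0, set0; split=> // e f l _ _ /elt_ext_type tl /elt_ext_type.
    by rewrite -tl => -[] /ij.
  (* The first edges of p and of q are excluded: a path starting with other edges e and f extends
     (p, q) only if both are null, against [pq0]. *)
  subst j; exists [set e | ohead p.2 = Some e], [set e | ohead q.2 = Some e].
  split; try exact: finite_bad_edges.
  have bad (G : digraph) (r : finpath G) o e g : ohead r.2 <> Some e ->
      gpath_ext (o, [:: e]) g -> gpath_ext r g -> r.2 = [::].
    case: r => b [//|e' es] /= H; rewrite !gpath_extE /= => -[_ g1] [_ g2].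
    case: H; case: g g1 g2 => [[c [|e1 es1]]|f] //=; rewrite ?take0.
      by move=> [->] [->].
    by move=> [->] [->].
  move=> e f l nB nC; case: l => [g|k g h]; first by move/elt_ext_type.
  move=> tl; have ij := elt_ext_type tl; have {}ij : i = k by case: ij.
  subst k; move: tl; rewrite !elt_extP => -[eg fh] [pg qh].
  move: pq0; rewrite /finpath_len (bad _ _ _ _ _ nB eg pg) (bad _ _ _ _ _ nC fh qh).
  by case.
case=> B [C [fB fC H]].
have [Ly Mu] : inf_emitter (E i) y /\ inf_emitter (F i) u.
  by move: (svalP x); rewrite Ex.
have [e [ey nB]] := infinite_setN0 (infinite_setD Ly fB).
have [f [fu nC]] := infinite_setN0 (infinite_setD Mu fC).
by exists e, f; split=> //; apply: H.
Qed.

(** Truncation provides a point nu a of U with [a] a vertex. By continuity of z |-> nu z, U pulls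
    back to a neighbourhood of the vertex path [a], which contains the cylinder of some pair (e,
    f). *)
Lemma open_contains_Zset U : open U -> U !=set0 ->
  exists2 nu, is_fmpath v w nu & Z nu `<=` U.
Proof.
move=> oU [x Ux].
pose Fl := [set U' : set (pathspace v w) | exists N, forall y,
  (forall lam, fmpath_size lam <= N -> Z lam y <-> Z lam x) -> U' y].
have FF : Filter Fl.
  split.
  - by exists 0.
  - move=> U1 U2 [N1 H1] [N2 H2]; exists (maxn N1 N2) => y H.
    by split; [apply: H1|apply: H2] => lam lamN; apply: H; rewrite leq_max lamN ?orbT.
  - by move=> U1 U2 U12 [N H]; exists N => y /H /U12.
have [N HN] : Fl U.
  apply: (@Zset_filter_nbhs _ _ v w Fl x); last exact: open_nbhs_nbhs.
  by move=> lam Wlam; exists (fmpath_size lam) => y; apply.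
have [nu [a [Wnu Wa nua H]]] := impath_truncate N (svalP x).
pose z : pathspace v w := exist _ (IV a) Wa.
have zU : U (pcat nu z).
  apply: HN => lam lamN; rewrite !ZsetE H// sval_pcat//=.
have : nbhs z [set y | Z (FV (mterm nu)) y -> U (pcat nu y)].
  by apply: nbhs_pcat_preimage => //; apply: open_nbhs_nbhs.
have Ez : sval z = IV a by [].
case: a Wa z nua {H} zU Ez => [i y u|//] Wa z nua zU Ez.
move/(nbhs_IV Ez) => [e [f [ey fu H]]].
have W1 : is_fmpath v w (FS [::] (FP (y, [:: e]) (u, [:: f]))).
  by split=> //; split=> //; left.
exists (fmpath_cat nu (FS [::] (FP (y, [:: e]) (u, [:: f])))).
  by have [] := @is_fmpath_cat _ _ v w nu _ Wnu W1 (esym nua).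
move=> t; rewrite Zset_catP// => -[t' /[dup] Ht' /H + ->]; apply.
by rewrite /= (Zset_orig Ht').
Qed.

(** * Disjoint extensions through a_0 *)

Definition loop N : fmpath E F :=
  FS [::] (FD (Da false, rcons (nseq N (Dbeta false)) (Dgamma false))).

Lemma is_fmpath_loop N : [/\ is_fmpath v w (loop N), morig (loop N) = Oa false
  & mterm (loop N) = Oa false].
Proof.
have T es : last (Da false) (map D_term (rcons es (Dgamma false))) = Da false.
  by rewrite map_rcons last_rcons.
split=> //; last by rewrite /= /finpath_term T.
split=> //; split; last by rewrite /finpath_len size_rcons.
by rewrite /is_finpath /=; elim: N.
Qed.

(** For N < M, the edge at position N is gamma_0 in one word and beta_0 in the other. *)
Lemma loop_disjoint N M (x : pathspace v w) : Z (loop N) x -> Z (loop M) x -> N = M.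
Proof.
wlog NM : N M / N <= M.
  by move=> H HN HM; have [NM|/ltnW MN] := leqP N M; [exact: H|exact/esym/H].
move=> /Zset_felt[l x0 Hl] /Zset_felt[l' x0' Hl'].
move: x0' Hl Hl'; rewrite x0 => -[<-]; case: l {x0} => // g;
  rewrite /elt_ext !gpath_extE /= !size_rcons !size_nseq.
move=> [_ HN] [_ HM]; apply/eqP; rewrite eqn_leq NM leqNgt; apply/negP => lt_NM.
have : nth (Dgamma false) (gtake g N.+1) N = nth (Dgamma false) (gtake g M.+1) N.
  case: (g) => [q|f] /=; first by rewrite !nth_take// (ltn_trans NM).
  by rewrite !nth_mkseq// (leq_ltn_trans NM).
by rewrite -HN -HM !nth_rcons !size_nseq ltnn eqxx lt_NM nth_nseq lt_NM.
Qed.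

(** The index N alone separates the cylinders; the final piece [tau b] only adjusts the terminus,
    and nothing is claimed for equal N and different b. *)
Lemma disjoint_extensions nu : is_fmpath v w nu ->
  exists f : nat -> Overt E F -> fmpath E F,
    [/\ forall N b, is_fmpath v w (f N b) /\ mterm (f N b) = b,
        forall N b, Z (f N b) `<=` Z nu &
        forall N b M c x, Z (f N b) x -> Z (f M c) x -> N = M].
Proof.
move=> Wnu; have [sg [Wsg osg tsg]] := connected (mterm nu) (Oa false).
have [tau Htau] := choice (connected (Oa false)).
have [Wb ob tb] := is_fmpath_cat Wnu Wsg osg.
pose base N := fmpath_cat (fmpath_cat nu sg) (loop N).
have Wbase N : [/\ is_fmpath v w (base N), morig (base N) = morig nu
  & mterm (base N) = Oa false].
  have [Wl ol tl] := is_fmpath_loop N.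
  have [] := @is_fmpath_cat _ _ v w (fmpath_cat nu sg) (loop N) Wb Wl.
    by rewrite tb tsg.
  by rewrite ob tl.
have Wf N b : [/\ is_fmpath v w (fmpath_cat (base N) (tau b)) ,
    mterm (fmpath_cat (base N) (tau b)) = b &
    Z (fmpath_cat (base N) (tau b)) `<=` Z (base N)].
  have [Wt ot tt] := Htau b; have [WN oN tN] := Wbase N.
  have otN : morig (tau b) = mterm (base N) by rewrite ot tN.
  have [W1 o1 t1] := is_fmpath_cat WN Wt otN.
  split=> //; first by rewrite t1.
  move=> x; rewrite Zset_catP// => -[z Hz ->]; apply/ZsetP => //; exists z => //.
  by rewrite /= (Zset_orig Hz).
have loopE N x : Z (base N) x -> exists2 z, Z (loop N) z
  & x = pcat (fmpath_cat nu sg) z.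
  have [Wl ol tl] := is_fmpath_loop N.
  by move/Zset_catP; apply => //; rewrite tb tsg.
have lorig N z : Z (loop N) z -> Z (FV (mterm (fmpath_cat nu sg))) z.
  by move/Zset_orig; rewrite /= tb tsg.
exists (fun N b => fmpath_cat (base N) (tau b)); split.
- by move=> N b; have [] := Wf N b.
- move=> N b x; have [_ _ H] := Wf N b; move/H/loopE => [z Hz ->].
  have zsg : Z (FV (mterm sg)) z by have := lorig _ _ Hz; rewrite /= tb.
  rewrite pcat_cat//; apply/ZsetP => //; exists (pcat sg z) => //.
  by rewrite /= sval_pcat//; have [_ ->] := is_impath_cat hv hw Wsg (svalP z) zsg.
- move=> N b M c x; have [_ _ H] := Wf N b; have [_ _ H'] := Wf M c.
  move=> /H/loopE[z Hz ->] /H'/loopE[z' Hz'] /(pcat_inj hv hw Wb) zz'.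
  have E0 : z = z' by apply: zz'; [apply: lorig Hz|apply: lorig Hz'].
  by apply: loop_disjoint Hz _; rewrite E0.
Qed.

End Density.

(** * The section glued from the bisections U(t(nu), nu) *)

Section Groupoid.
Context {E F : bool -> digraph}.
Variables (v : forall i, vert (E i)) (w : forall i, vert (F i)).
Hypotheses (hv : forall i, inf_emitter (E i) (v i))
  (hw : forall i, inf_emitter (F i) (w i)).
Implicit Types (mu nu lam : fmpath E F) (x y z : pathspace v w).
Implicit Types (g : spielberg_groupoid v w).

Local Notation iorig := (impath_orig v w).
Local Notation morig := (@fmpath_orig E F v w).
Local Notation mterm := (fmpath_term v w).
Local Notation Z := (@Zset E F v w).
Local Notation src := (@gsource E F v w).

(** This picks out (z, -l(nu), nu z), with range z and source nu z. It is a relation because an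
    element of the groupoid also carries a proof of membership. *)
Definition shift_elt nu z g : Prop :=
  Z (FV (mterm nu)) z /\ sval g = (z, deg (FV (mterm nu)) nu, pcat nu z).

Lemma groupoid_eq g g' : sval g = sval g' -> g = g'.
Proof.
by case: g g' => [g Wg] [g' Wg'] /= gg'; subst g'; congr exist; apply: Prop_irrelevance.
Qed.

Lemma shift_elt_exists nu z : is_fmpath v w nu -> Z (FV (mterm nu)) z ->
  exists g, shift_elt nu z g.
Proof.
move=> Wnu znu.
have W : exists mu nu' z', [/\ is_fmpath v w mu, is_fmpath v w nu' &
    triple_of mu nu' z' (z, deg (FV (mterm nu)) nu, pcat nu z)].
  by exists (FV (mterm nu)), nu, z; split=> //; split=> //=; rewrite sval_pcat.
by exists (exist _ (z, deg (FV (mterm nu)) nu, pcat nu z) W : spielberg_groupoid v w).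
Qed.

Lemma shift_bisection nu g : is_fmpath v w nu ->
  bisection (FV (mterm nu)) nu (Z (FV (mterm nu))) (Z nu) g <->
  exists z, shift_elt nu z g.
Proof.
move=> Wnu; split.
  case=> -[z [/= nuz _ E1 E2 Ed]] _ _; exists z; split; first by rewrite /= nuz.
  move: E1 E2 Ed; case: (sval g) => -[x d] y /= E1 E2 ->.
  by rewrite (pathspace_eq E1); congr pair; apply: pathspace_eq;
    rewrite E2 sval_pcat//= nuz.
case=> z [znu Eg]; split.
- by exists z; rewrite Eg; split=> //=; rewrite sval_pcat.
- by rewrite /grange Eg.
- by rewrite /gsource Eg; apply/ZsetP => //; exists z.
Qed.

Lemma groupoid_base_nbhs (Fl : set_system (spielberg_groupoid v w)) g : Filter Fl ->
  (forall W, @groupoid_base E F v w W -> W g -> Fl W) ->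
  forall U, nbhs g U -> Fl U.
Proof.
move=> FF H U; rewrite nbhsE => -[V [[D sD <-] [W DW Wg]] VU].
apply: (filterS VU); apply: (@filterS _ _ _ W); first by move=> h Wh; exists W.
have [A sA EW] := sD _ DW; move: Wg; rewrite /= -EW => Wg.
by apply: filter_bigI => V' AV'; apply: H; [exact/set_mem/sA|apply: Wg].
Qed.

Lemma groupoid_base_open W : @groupoid_base E F v w W -> open W.
Proof.
move=> bW; exists [set W]; last by rewrite bigcup_set1.
move=> _ ->; exists [fset W]%fset; first by move=> V /fset1P ->; apply/mem_set.
by rewrite set_fset1 bigcap_set1.
Qed.

Lemma groupoid_base_nbhs_mem W g : @groupoid_base E F v w W -> W g -> nbhs g W.
Proof. by move=> bW Wg; apply: open_nbhs_nbhs; split=> //;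
  apply: groupoid_base_open. Qed.

Lemma shift_bisection_base nu : is_fmpath v w nu ->
  groupoid_base (bisection (FV (mterm nu)) nu (Z (FV (mterm nu))) (Z nu)).
Proof. by move=> Wnu; left; exists (FV (mterm nu)), nu. Qed.

Lemma shift_elt_inj nu z z' g : shift_elt nu z g -> shift_elt nu z' g -> z = z'.
Proof. by move=> [_ Eg] [_]; rewrite Eg => -[]. Qed.

Lemma deg_cat mu nu a : is_fmpath v w nu -> deg mu (fmpath_cat nu mu) = deg (FV a) nu.
Proof.
move=> Wnu; rewrite /deg; have [-> ->] := fmpath_len_cat mu Wnu.
by congr pair; rewrite /=; lia.
Qed.

Lemma deg_cat_inv mu mu' nu a : is_fmpath v w nu -> deg (FV a) nu = deg mu mu' ->
  fmpath_len mu' = fmpath_len (fmpath_cat nu mu).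
Proof.
move=> Wnu; rewrite /deg; have [E1 E2] := fmpath_len_cat mu Wnu => -[H1 H2].
rewrite [LHS]surjective_pairing [RHS]surjective_pairing E1 E2.
by congr pair; move: H1 H2; rewrite /=; lia.
Qed.

(** Equivalently, the range map is continuous on U(t(nu), nu). A generating set around z based at
    lam corresponds to the generating bisection of lam and nu lam, whose degree is again -l(nu). *)
Lemma nbhs_shift_elt nu z g U : is_fmpath v w nu -> shift_elt nu z g -> nbhs z U ->
  nbhs g [set h | exists2 y, U y & shift_elt nu y h].
Proof.
move=> Wnu gz; have [znu Eg] := gz.
pose Fl := [set U' | nbhs g [set h | exists2 y, U' y & shift_elt nu y h]].
have FF : Filter Fl.
  split.
  - apply: filterS (groupoid_base_nbhs_mem (shift_bisection_base Wnu) _).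
      by move=> h /(shift_bisection _ Wnu)[y hy]; exists y.
    by apply/shift_bisection => //; exists z.
  - move=> A B FA FB; apply: filterS (@filterI _ (nbhs g) _ _ _ FA FB).
    move=> h [[y Ay hy] [y' By' hy']]; exists y => //; split=> //.
    by rewrite (shift_elt_inj hy hy').
  - move=> A B AB; rewrite /Fl /=; apply: filterS => h [y Ay hy].
    by exists y => //; apply: AB.
apply: (@pathspace_base_nbhs _ _ v w Fl z) => W bW Wz; rewrite /Fl /=.
have sub lam W0 W1 : is_fmpath v w lam -> Z lam z -> W0 z -> W1 (pcat nu z) ->
    groupoid_base (bisection lam (fmpath_cat nu lam) W0 W1) ->
    nbhs g [set h | exists2 y, W0 y & shift_elt nu y h].
  move=> Wlam lamz W0z W1z bb.
  have lamnu : morig lam = mterm nu by rewrite -(Zset_orig lamz).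
  have [Wc oc tc] := is_fmpath_cat Wnu Wlam lamnu.
  apply: filterS (groupoid_base_nbhs_mem bb _).
    move=> h [[t [lamt _ E1 E2 Ed]] W0h _]; exists (grange h) => //.
    have tlam : Z (FV (mterm lam)) t by rewrite /= lamt.
    have E1' : grange h = pcat lam t by apply: pathspace_eq; rewrite sval_pcat.
    have tnu : Z (FV (mterm nu)) (pcat lam t).
      rewrite /= sval_pcat//.
      by have [_ ->] := is_impath_cat hv hw Wlam (svalP t) tlam.
    split; first by rewrite E1'.
    have E2' : gsource h = pcat nu (pcat lam t).
      by apply: pathspace_eq; rewrite E2 -pcat_cat// sval_pcat//= tc lamt.
    move: E1' E2' Ed; rewrite /grange /gsource (deg_cat _ (mterm nu) Wnu).
    by case: (sval h) => -[a d] b /= -> -> ->.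
  split; rewrite ?/grange ?/gsource ?Eg//.
  have [t tlam Ez] := proj1 (ZsetP hv hw z Wlam) lamz.
  have lamt : mterm lam = iorig (sval t) by [].
  exists t; split=> //=.
  - by rewrite tc.
  - by rewrite Ez sval_pcat.
  - by rewrite Ez -pcat_cat// sval_pcat//= tc.
  - by rewrite (deg_cat _ (mterm nu) Wnu).
case: bW Wz => [[lam Wlam ->]|[lam [i [a [u [B [C [Wlam lamau aB aC ->]]]]]]]] lamz.
  have lamnu : morig lam = mterm nu by rewrite -(Zset_orig lamz).
  have [Wc oc tc] := is_fmpath_cat Wnu Wlam lamnu.
  apply: (sub lam (Z lam) (Z (fmpath_cat nu lam))) => //.
    by apply/Zset_catP => //; exists z.
  by left; exists lam, (fmpath_cat nu lam).
have lamz' : Z lam z by case: lamz => -[].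
have lamnu : morig lam = mterm nu by rewrite -(Zset_orig lamz').
have [Wc oc tc] := is_fmpath_cat Wnu Wlam lamnu.
apply: (sub lam _ (Vset_minus (fmpath_cat nu lam) a u B C)) => //.
  exact/Vset_minus_cat.
by right; exists lam, (fmpath_cat nu lam), i, a, u, B, C; rewrite tc.
Qed.

Lemma Vset_minus_base_open mu i (a : vert (E i)) (u : vert (F i)) B C :
  is_fmpath v w mu -> mterm mu = Oprod a u -> admissible a B -> admissible u C ->
  open (@Vset_minus E F v w mu i a u B C).
Proof.
move=> Wmu muau aB aC; apply: pathspace_base_open; right.
by exists mu, i, a, u, B, C.
Qed.

Section Family.
Variable D : set (fmpath E F).
Hypothesis D_fmpath : forall nu, D nu -> is_fmpath v w nu.
Hypothesis D_disjoint : forall mu nu x, D mu -> D nu -> Z mu x -> Z nu x -> mu = nu.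

Definition shift_section : set (spielberg_groupoid v w) :=
  [set g | exists nu z, D nu /\ shift_elt nu z g].

Lemma shift_sectionE : shift_section =
  \bigcup_(nu in D) bisection (FV (mterm nu)) nu (Z (FV (mterm nu))) (Z nu).
Proof.
apply/seteqP; split=> g.
  move=> [nu [z [Dnu gz]]]; exists nu => //; apply/shift_bisection;
    first exact: D_fmpath.
  by exists z.
by case=> nu Dnu /(shift_bisection _ (D_fmpath Dnu))[z gz]; exists nu, z.
Qed.

Lemma shift_section_open : open shift_section.
Proof.
rewrite shift_sectionE; apply: bigcup_open => nu Dnu.
by apply: groupoid_base_open; apply: shift_bisection_base; apply: D_fmpath.
Qed.

Lemma shift_section_source : src @` shift_section = \bigcup_(nu in D) Z nu.
Proof.
apply/seteqP; split=> x.
  move=> [g [nu [z [Dnu [znu Eg]]]] <-]; exists nu => //.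
  by apply/(ZsetP hv hw _ (D_fmpath Dnu)); exists z => //; rewrite /gsource Eg.
move=> [nu Dnu] /(ZsetP hv hw _ (D_fmpath Dnu))[z znu ->].
have [g gz] := shift_elt_exists (D_fmpath Dnu) znu.
exists g; first by exists nu, z.
by case: gz => _; rewrite /gsource => ->.
Qed.

(** Disjointness of the cylinders lets the source tell which [nu] was used; within one cylinder, nu
    cancels on the left. *)
Lemma shift_section_inj g h : shift_section g -> shift_section h ->
  gsource g = gsource h -> g = h.
Proof.
move=> [nu [z [Dnu [znu Eg]]]] [mu [y [Dmu [ymu Eh]]]]; rewrite /gsource Eg Eh /= => E0.
have Zz : Z nu (pcat nu z) by apply/(ZsetP hv hw _ (D_fmpath Dnu)); exists z.
have Zy : Z mu (pcat mu y) by apply/(ZsetP hv hw _ (D_fmpath Dmu)); exists y.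
have Enm : nu = mu by apply: (D_disjoint Dnu Dmu Zz); rewrite E0.
subst mu; have zy := pcat_inj hv hw (D_fmpath Dnu) znu ymu E0.
by apply: groupoid_eq; rewrite Eg Eh zy.
Qed.

(** On the piece of nu the source is the range followed by z |-> nu z; continuity of the two factors
    is [nbhs_shift_elt] and [nbhs_pcat_preimage]. *)
Lemma shift_section_source_continuous :
  {within shift_section, continuous (@gsource E F v w)}.
Proof.
rewrite (continuous_open_subspace _ shift_section_open) => g.
rewrite inE => -[nu [z [Dnu gz]]] U; have [znu Eg] := gz.
rewrite {1}/gsource Eg /= => nU.
have Wnu := D_fmpath Dnu.
have N := nbhs_shift_elt Wnu gz (nbhs_pcat_preimage hv hw Wnu znu nU).
suff : nbhs g [set h | U (gsource h)] by [].
apply: filterS N => h [y H [ynu Eh]] /=.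
by rewrite /gsource Eh; apply: H.
Qed.

(** Locally the inverse is nu y |-> (y, -l(nu), nu y). If a generating bisection of mu1 and mu2
    contains t(x), then x extends both mu2 and nu mu1, which have equal length; hence mu2 = nu mu1,
    and the values at nearby points lie in the bisection too. *)
Lemma shift_section_inv_continuous (t : pathspace v w -> spielberg_groupoid v w) :
  (forall x, (src @` shift_section) x -> shift_section (t x) /\ gsource (t x) = x) ->
  {within src @` shift_section, continuous t}.
Proof.
move=> Ht.
have oS : open (src @` shift_section).
  rewrite shift_section_source; apply: bigcup_open => nu Dnu.
  by apply: open_Zset; apply: D_fmpath.
rewrite (continuous_open_subspace _ oS) => x; rewrite inE => Sx.
have [[nu [z [Dnu gz]]] Es] := Ht _ Sx; have Wnu := D_fmpath Dnu.
have [znu Eg] := gz; have Ex : x = pcat nu z by rewrite -Es /gsource Eg.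
have tE y : Z (FV (mterm nu)) y -> shift_elt nu y (t (pcat nu y)).
  move=> ynu; have [h hy] := shift_elt_exists Wnu ynu.
  have Sh : shift_section h by exists nu, y.
  have Eh : gsource h = pcat nu y by case: hy => _; rewrite /gsource => ->.
  have [|St Et] := Ht (pcat nu y); first by exists h.
  by rewrite (@shift_section_inj (t (pcat nu y)) h) // Et Eh.
have FF : Filter (t @ x) by apply: fmap_filter; exact: nbhs_filter.
apply: (@groupoid_base_nbhs (t @ x) (t x)) => W bW Wg.
have sub mu1 mu2 W1 W2 : is_fmpath v w mu1 -> is_fmpath v w mu2 ->
    open W1 -> open W2 -> W1 `<=` Z mu1 -> W2 `<=` Z mu2 ->
    bisection mu1 mu2 W1 W2 (t x) -> (t @ x) (bisection mu1 mu2 W1 W2).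
  move=> Wmu1 Wmu2 o1 o2 s1 s2 [[c [oc1 oc2 E1 E2 Ed]] H1 H2].
  have H1' : W1 z by move: H1; rewrite /grange Eg.
  have H2' : W2 x by move: H2; rewrite Es.
  have mu1nu : morig mu1 = mterm nu by rewrite -(Zset_orig (s1 _ H1')).
  have [Wc oc tc] := is_fmpath_cat Wnu Wmu1 mu1nu.
  have Emu2 : mu2 = fmpath_cat nu mu1.
    apply: (@impath_ext_uniq _ _ v w _ _ (sval x)) => //.
    - exact/ZsetE/s2.
    - by apply/ZsetE; rewrite Ex; apply/Zset_cat => //; apply: s1.
    - by apply: (deg_cat_inv (a := mterm nu) Wnu); rewrite -Ed Eg.
  have n1 : nbhs x (pcat nu @` (W1 `&` Z (FV (mterm nu)))).
    by rewrite Ex; apply: nbhs_pcat => //; apply: open_nbhs_nbhs.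
  have n2 : nbhs x W2 by apply: open_nbhs_nbhs.
  apply: filterS (filterI n1 n2) => _ [[y [W1y ynu] <-] W2y] /=.
  have [_ Et] := tE _ ynu; split; rewrite ?/grange ?/gsource ?Et//.
  have [d dmu1 Ey] := proj1 (ZsetP hv hw y Wmu1) (s1 _ W1y).
  exists d; split=> //=.
  - by rewrite Emu2 tc.
  - by rewrite Ey sval_pcat.
  - by rewrite Ey -pcat_cat// sval_pcat ?Emu2//= tc.
  - by rewrite Emu2 (deg_cat _ (mterm nu) Wnu).
case: bW Wg => [[mu1 [mu2 [W1 W2 _ ->]]]|].
  by apply: sub => //; apply: open_Zset.
case=> mu1 [mu2 [i [a [u [B [C [[W1 W2] [t1 t2] aB aC ->]]]]]]].
apply: sub => //; try exact: Vset_minus_base_open.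
- by move=> y [[]].
- by move=> y [[]].
Qed.

Lemma shift_section_open_s_section : open_s_section (@gsource E F v w) shift_section.
Proof.
(* Off the source set the inverse takes a junk value; the unit (x, 0, x) shows that one exists. *)
have T x : exists g, (src @` shift_section) x -> shift_section g /\ gsource g = x.
  have [[g Sg <-]|nS] := pselect ((src @` shift_section) x); first by exists g.
  have [g _] := @shift_elt_exists (FV (iorig (sval x))) x I erefl.
  by exists g.
have [t Ht] := choice T.
split; first exact: shift_section_open.
  rewrite shift_section_source; apply: bigcup_open => nu Dnu.
  by apply: open_Zset; apply: D_fmpath.
exists t; split.
- move=> g; rewrite inE => Sg; have [|St Et] := Ht (gsource g); first by exists g.
  exact: shift_section_inj.
- exact: shift_section_source_continuous.
- exact: shift_section_inv_continuous.
Qed.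

(** A point x is the range of the element over x in the piece of a [nu] that ends at the origin of
    x, so one path per vertex makes the range everything. *)
Lemma shift_section_prec (K O : set (pathspace v w)) :
  (forall a, exists2 nu, D nu & mterm nu = a) -> (forall nu, D nu -> Z nu `<=` O) ->
  prec (@grange E F v w) (@gsource E F v w) K O.
Proof.
move=> Dterm DO; exists shift_section; split.
- exact: shift_section_open_s_section.
- move=> x _; have [nu Dnu nux] := Dterm (iorig (sval x)).
  have [g gx] := @shift_elt_exists nu x (D_fmpath Dnu) (esym nux).
  exists g; first by exists nu, x.
  by case: gx => _; rewrite /grange => ->.
- by rewrite shift_section_source => x [nu Dnu]; apply: DO.
Qed.

End Family.

End Groupoid.

(** * Numbering the vertices, and the conclusion *)

Lemma countable_Overt (E F : bool -> digraph) :
  (forall i, countable_graph (E i)) -> (forall i, countable_graph (F i)) ->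
  exists c : Overt E F -> nat, injective c.
Proof.
move=> cE cF.
have cV (G : digraph) : countable_graph G -> exists f : vert G -> nat, injective f.
  case=> /countable_injP[f fi] _; exists f => x y; apply: fi; exact: mem_set.
pose f i := sval (cid (cV _ (cE i))); pose g i := sval (cid (cV _ (cF i))).
have fi i : injective (f i) := svalP (cid (cV _ (cE i))).
have gi i : injective (g i) := svalP (cid (cV _ (cF i))).
(* Both kinds of vertices are coded by quadruples of one countable type; the first boolean tells
   them apart, and zeros pad the code of a_i. *)
exists (fun a : Overt E F => match a with
  | Oprod i y u => choice.pickle (true, i, f i y, g i u)
  | Oa i => choice.pickle (false, i, 0, 0) end).
case=> [i y u|i] [j y' u'|j] /(pcan_inj choice.pickleK) // => [[ij]|[->]//].
by subst j => /fi -> /gi ->.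
Qed.

(** Every finite path continues to u_0, and this vertex is itself an infinite path. *)
Lemma Zset_nonempty (E F : bool -> digraph)
    (v : forall i, vert (E i)) (w : forall i, vert (F i)) (mu : fmpath E F) :
  (forall i, inf_emitter (E i) (v i)) -> (forall i, inf_emitter (F i) (w i)) ->
  (forall i, irreducible (E i)) -> (forall i, irreducible (F i)) ->
  is_fmpath v w mu -> @Zset E F v w mu !=set0.
Proof.
move=> hv hw hE hF Wmu.
have [rho [Wrho orho trho]] := connected v w hE hF (fmpath_term v w mu) (Ou v w false).
have Wu : is_impath v w (IV (Ou v w false)) by [].
pose u : pathspace v w := exist _ (IV (Ou v w false)) Wu.
have urho : Zset (FV (fmpath_term v w rho)) u by rewrite /= trho.
exists (pcat mu (pcat rho u)); apply/(ZsetP hv hw _ Wmu).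
exists (pcat rho u) => //; rewrite /= sval_pcat//.
by have [_ ->] := is_impath_cat hv hw Wrho Wu (esym trho).
Qed.

Theorem proposition5p10 (E F : bool -> digraph)
    (v : forall i, vert (E i)) (w : forall i, vert (F i))
    (hEcount : forall i, countable_graph (E i))
    (hFcount : forall i, countable_graph (F i))
    (hEirr : forall i, irreducible (E i))
    (hFirr : forall i, irreducible (F i))
    (hv : forall i, inf_emitter (E i) (v i))
    (hw : forall i, inf_emitter (F i) (w i)) :
  purely_infinite (@grange E F v w) (@gsource E F v w).
Proof.
move=> O1 O2 _ oO2 _ O2n0 _ K _ _.
have [nu Wnu nuO2] := open_contains_Zset hv hw hEirr hFirr oO2 O2n0.
have [f [Wf fnu fdisj]] := disjoint_extensions hv hw hEirr hFirr Wnu.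
have [c ci] := countable_Overt hEcount hFcount.
(* The path to b uses the loop index j + 2 c(b), with j read as 0 or 1: distinct vertices get
   distinct indices because [c] is injective, and the parity of the index is j. *)
pose D (j : bool) := [set mu | exists b, mu = f (j + (c b).*2) b].
pose V j := \bigcup_(mu in D j) (@Zset E F v w mu).
have WD j mu : D j mu -> is_fmpath v w mu by case=> b ->;
  have [] := Wf (j + (c b).*2) b.
have DD j : forall mu mu' x, D j mu -> D j mu' ->
    @Zset E F v w mu x -> @Zset E F v w mu' x -> mu = mu'.
  move=> _ _ x [b ->] [b' ->] xb xb'.
  have /addnI/double_inj/ci -> // := fdisj _ _ _ _ _ xb xb'.
have VO2 j : V j `<=` O2.
  by move=> x [mu [b ->]] xb; apply: nuO2; apply: fnu xb.
have oV j : open (V j).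
  by apply: bigcup_open => mu /WD; apply: open_Zset.
have Vn0 j : V j !=set0.
  have Df : D j (f (j + (c (Oa false)).*2) (Oa false)) by exists (Oa false).
  have [x xf] := Zset_nonempty hv hw hEirr hFirr (WD _ _ Df).
  by exists x; exists (f (j + (c (Oa false)).*2) (Oa false)).
have pV j : prec (@grange E F v w) (@gsource E F v w) K (V j).
  apply: (shift_section_prec hv hw (WD j) (DD j)) => [b|mu Dmu].
    by exists (f (j + (c b).*2) b); [exists b|have [_ ->] := Wf (j + (c b).*2) b].
  by move=> x xmu; exists mu.
exists (V false), (V true); split=> //.
apply/seteqP; split=> // x [[mu [b ->]] xb] [mu' [b' ->]] xb'.
have /(congr1 odd) := fdisj _ _ _ _ _ xb xb'.
by rewrite !oddD !odd_double.
Qed.
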